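(* Let $\nu>0$ and $\alpha\in\mathbb{R}$. The family of functions $\psi_{m,n}^{\alpha,\nu}$, $(m,n)\in\mathbb{Z}^+\times\mathbb{Z}$, defined for $z=x+iy$ ($x,y\in\mathbb{R}$) by $$\psi_{m,n}^{\alpha,\nu}(z,\overline{z})=C_{m,n}^{\alpha,\nu}\,e^{\frac{\nu}{2}z^2+2i\pi(\alpha+n)z}\,H_m\!\left(\sqrt{2\nu}\,y+\sqrt{\tfrac{2}{\nu}}\,\pi(n+\alpha)\right),\qquad C_{m,n}^{\alpha,\nu}:=(2^m m!)^{-1/2}\left(\frac{2\nu}{\pi}\right)^{1/4}e^{-\frac{\pi^2}{\nu}(\alpha+n)^2},$$ is a complete orthonormal system in $\mathcal{L}^{2,\nu}_{\alpha}(\mathbb{C})$.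
   Context: $\mathbb{Z}^+=\{0,1,2,\dots\}$, and $H_m$ denotes the $m$-th (physicists') Hermite polynomial, $H_m(\xi)=(-1)^m e^{\xi^2}\frac{d^m}{d\xi^m}e^{-\xi^2}$, orthogonal with respect to $e^{-\xi^2}d\xi$. Let $d\lambda(z)=dx\,dy$ be Lebesgue measure on $\mathbb{C}$ and $S=[0,1]\times\mathbb{R}=\{x+iy:0\le x\le1,\ y\in\mathbb{R}\}$. The space $\mathcal{L}^{2,\nu}_{\alpha}(\mathbb{C})$ consists of the (classes modulo almost everywhere equality of) measurable functions $f:\mathbb{C}\to\mathbb{C}$ satisfying $$f(z+m)=e^{2i\pi\alpha m}e^{\nu(z+\frac m2)m}f(z)\qquad\text{for almost every }z\in\mathbb{C}\text{ and all }m\in\mathbb{Z},$$ and $\|f\|_\nu^2=\int_S|f(z)|^2e^{-\nu|z|^2}d\lambda(z)<+\infty$. It is equipped with the inner product $\langle f_1,f_2\rangle_\nu=\int_S f_1(z)\overline{f_2(z)}e^{-\nu|z|^2}d\lambda(z)$. *)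

(* Defs.v *)
From HB Require Import structures.
From mathcomp Require Import all_boot all_order all_algebra.
From mathcomp Require Import complex.
From mathcomp Require Import all_classical all_reals all_analysis.

Set Implicit Arguments.
Unset Strict Implicit.
Unset Printing Implicit Defensive.

Import Order.TTheory GRing.Theory Num.Theory.
Import numFieldNormedType.Exports.

Local Open Scope classical_set_scope.
Local Open Scope ring_scope.
Local Open Scope complex_scope.

Section Defs.
Variable R : realType.
Local Notation C := R[i].
Local Notation plane := (measurableTypeR R * measurableTypeR R)%type.

Definition cexp (z : C) : C :=
  (expR (complex.Re z))%:C * (cos (complex.Im z) +i* sin (complex.Im z)).

(* [complex R] carries no measurable structure in the library: measurability
   and integrals on C are taken in the real coordinates (x, y) of z = x + i y. *)
Definition ofR2 (p : plane) : C := p.1 +i* p.2.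

Local Notation lebesgue2 := (@lebesgue_measure R \x @lebesgue_measure R)%E.

Definition cmeasurable (f : C -> C) : Prop :=
  measurable_fun [set: plane] (fun p => complex.Re (f (ofR2 p))) /\
  measurable_fun [set: plane] (fun p => complex.Im (f (ofR2 p))).

(* [0, 1] x R, in real coordinates *)
Definition strip : set plane := `[0, 1] `*` setT.

Definition gauss_weight (nu : R) (z : C) : R :=
  expR (- nu * ComplexField.Normc.normc z ^+ 2).

Definition sqnorm (nu : R) (f : C -> C) : \bar R :=
  (\int[lebesgue2]_(p in strip)
     (ComplexField.Normc.normc (f (ofR2 p)) ^+ 2
      * gauss_weight nu (ofR2 p))%:E)%E.

Definition inner (nu : R) (f g : C -> C) : C :=
  let h p := f (ofR2 p) * (g (ofR2 p))^* * (gauss_weight nu (ofR2 p))%:C in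
  Rintegral lebesgue2 strip (fun p => complex.Re (h p)) +i*
  Rintegral lebesgue2 strip (fun p => complex.Im (h p)).

Definition quasi_periodic (alpha nu : R) (f : C -> C) : Prop :=
  {ae lebesgue2, forall p : plane, forall m : int,
     let z := ofR2 p in
     f (z + m%:~R) =
       cexp (2 * 'i%C * (pi * alpha)%:C * m%:~R)
       * cexp (nu%:C * (z + m%:~R / 2) * m%:~R) * f z}.

(* Elements are representatives of the classes modulo almost everywhere
   equality; [sqnorm] and [inner] only depend on the classes. *)
Definition L2_auto (alpha nu : R) : set (C -> C) :=
  [set f | [/\ cmeasurable f, quasi_periodic alpha nu f
             & (sqnorm nu f < +oo)%E]].

Definition orthonormal_system (I : eqType) (alpha nu : R) (e : I -> C -> C) :=
  (forall k, L2_auto alpha nu (e k)) /\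
  (forall j k, inner nu (e j) (e k) = (j == k)%:R).

(* the linear span of the family is dense *)
Definition complete_system (I : eqType) (alpha nu : R) (e : I -> C -> C) :=
  forall f, L2_auto alpha nu f -> forall eps : R, 0 < eps ->
  exists (s : seq I) (c : I -> C),
    (sqnorm nu (fun z => (f z - \sum_(k <- s) c k * e k z)%R)
       < (eps ^+ 2)%:E)%E.

Definition complete_orthonormal_system (I : eqType) (alpha nu : R)
    (e : I -> C -> C) :=
  orthonormal_system alpha nu e /\ complete_system alpha nu e.

(* physicists' Hermite polynomials, by the Rodrigues formula *)
Definition hermite (m : nat) (xi : R) : R :=
  (-1) ^+ m * expR (xi ^+ 2)
  * derive1n m (fun t : R => expR (- t ^+ 2)) xi.

Definition psi_const (alpha nu : R) (m : nat) (n : int) : R :=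
  ((2 ^ m * m`!)%N%:R `^ (- (1 / 2))) * ((2 * nu / pi) `^ (1 / 4))
  * expR (- (pi ^+ 2 / nu) * (alpha + n%:~R) ^+ 2).

Definition psi (alpha nu : R) (mn : nat * int) (z : C) : C :=
  let: (m, n) := mn in
  (psi_const alpha nu m n)%:C
  * cexp ((nu / 2)%:C * z ^+ 2 + 2 * 'i%C * (pi * (alpha + n%:~R))%:C * z)
  * (hermite m (Num.sqrt (2 * nu) * complex.Im z
                + Num.sqrt (2 / nu) * pi * (n%:~R + alpha)))%:C.

End Defs.

(* Main.v *)
Require Import Defs.
From mathcomp Require Import all_boot all_order all_algebra.
From mathcomp Require Import complex.
From mathcomp Require Import all_classical all_reals all_analysis measurable_realfun.
From mathcomp Require Import ring lra zify.

(** Write z = x + i y and let W be the Gaussian weight exp (- nu |z|^2). Multiplying f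
by the square root of W, and by the conjugate of the unimodular function
exp (i (nu x y + 2 pi alpha x)), turns the norm of the space into the plain L2 norm
of the strip [0, 1] x R. The same operation turns psi_(m, n) into the product
exp (2 i pi n x) h_m (a y + c_n) ([psi_weightedE]), where h_m is the m-th normalized
Hermite function, a = sqrt (2 nu), and the shift c_n depends on the frequency n.

Orthonormality. By Fubini the inner product of two such products is the product of
an integral over [0, 1] and an integral over R. The first one vanishes unless the
frequencies agree ([integral_unit_trig]), and in that case both Hermite functions
carry the same shift, so that Hermite orthogonality applies. The latter comes from
the identity: the integral of (p' - 2 X p) e^(-X^2) is 0 for every polynomial p. It
says that multiplication by H_1 minus differentiation is adjoint to differentiation,
so that pairing q with H_m is integrating the m-th derivative of q against the
Gaussian ([gauss_mean_hermite]).

Completeness. Let S be the L2-closure of the span. The Hermite polynomials span all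
polynomials, so S contains exp (2 i pi n x) p(y) e^(-(a y + c_n)^2 / 2) for every
polynomial p. The partial sums of the series of exp, cos and sin converge in L2 when
they are multiplied by a Gaussian ([power_series_mul]). Multiplying by exp (a c_n y)
removes the shift ([common_gaussE]), and multiplying by cos (t y + s) then shows that S
contains all functions cos (2 pi n x + t y + s) e^(-nu y^2): the Gaussian factor no
longer depends on n ([trigpoly_real_closure]).

The linear combinations of these cosines form an algebra of bounded functions, and
e^(-2 nu y^2) dx dy is a finite measure on the strip. It remains to apply a
Stone-Weierstrass theorem for L2 of a finite measure ([dense_of_generating_algebra]).
Suppose that a linear space is closed under dominated limits and contains a bounded
algebra A. If f is in A, then polynomials in f converge boundedly to the indicator of
the set where f > 0; Dynkin's lemma then reaches every set of the generated
sigma-algebra, and simple functions reach all of L2. That the cosines generate the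
Borel sets of the open strip is elementary ([trigpoly_generates]): y is the limit of
k sin (y / k), and for 0 < x, b < 1 the inequality x < b means that
sin (pi x) sin (pi (x - b)) < 0. *)

Set Implicit Arguments.
Unset Strict Implicit.
Unset Printing Implicit Defensive.

Import Order.TTheory GRing.Theory Num.Theory.
Import numFieldNormedType.Exports.

Local Open Scope classical_set_scope.
Local Open Scope ring_scope.
Local Open Scope complex_scope.

(** * Polynomials approximating a step *)

Section StepPolynomials.
Context {R : realType}.
Implicit Types s : R.

(** These polynomials converge on [0, 1] to the indicator of s < 1/2. With the exponent
2 ^ n alone the limit at s = 1/2 would be 1/e; the extra factor n makes it 0, so that the
convergence to an indicator holds at every point and not only almost everywhere. *)
Definition step_poly (n : nat) s : R := (1 - s ^+ n) ^+ (n * 2 ^ n).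

Lemma step_poly_itv n s : 0 <= s <= 1 -> 0 <= step_poly n s <= 1.
Proof.
move=> /andP[s0 s1]; rewrite /step_poly.
have sn0 : 0 <= s ^+ n by exact: exprn_ge0.
have sn1 : s ^+ n <= 1 by exact: exprn_ile1.
by rewrite exprn_ge0 ?exprn_ile1; lra.
Qed.

Lemma bernoulli_le (x : R) n : 0 <= x <= 1 -> 1 - n%:R * x <= (1 - x) ^+ n.
Proof.
move=> /andP[x0 x1]; elim: n => [|n IH]; first by rewrite mul0r subr0 expr0.
rewrite exprS -natr1.
have h : (1 - x) * (1 - n%:R * x) <= (1 - x) * (1 - x) ^+ n.
  by apply: ler_wpM2l => //; lra.
apply: le_trans h; have : 0 <= n%:R :> R by [].
by nra.
Qed.

(** With t = 2^-n: (1 - t)^(2^n) (1 + t)^(2^n) <= 1, and the second factor is at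
least 2 by Bernoulli's inequality. *)
Lemma step_poly_base_le n : (1 - (2^-1) ^+ n) ^+ (2 ^ n) <= 2^-1 :> R.
Proof.
set t : R := 2^-1 ^+ n.
have t0 : 0 < t by rewrite exprn_gt0// invr_gt0.
have t1 : t <= 1 by rewrite exprn_ile1//; lra.
have tn : (2 ^ n)%:R * t = 1 by rewrite /t natrX exprVn mulfV// expf_neq0.
have h1 : (1 - t) ^+ (2 ^ n) * (1 + t) ^+ (2 ^ n) <= 1.
  by rewrite -exprMn exprn_ile1; nra.
have h2 : 2 <= (1 + t) ^+ (2 ^ n).
  suff : forall k, 1 + k%:R * t <= (1 + t) ^+ k.
    by move=> /(_ (2 ^ n)%N); rewrite tn; lra.
  elim=> [|k IH]; first by rewrite mul0r addr0 expr0.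
  rewrite exprS -natr1.
  have : (1 + t) * (1 + k%:R * t) <= (1 + t) * (1 + t) ^+ k.
    by apply: ler_wpM2l => //; lra.
  apply: le_trans; have : 0 <= k%:R :> R by [].
  by nra.
have h3 : 0 <= (1 - t) ^+ (2 ^ n) by rewrite exprn_ge0//; lra.
have : (1 - t) ^+ (2 ^ n) * 2 <= 1.
  by apply: le_trans h1; apply: ler_wpM2l.
by lra.
Qed.

Lemma cvg_natM_geometric (r : R) : 0 <= r < 1 -> n%:R * r ^+ n @[n --> \oo] --> (0 : R).
Proof.
(* n r^n = (n t^n) t^n with t^2 = r, and n t^n (1 - t) <= 1 *)
move=> /andP[r0 r1]; pose t := Num.sqrt r.
have t0 : 0 <= t by exact: sqrtr_ge0.
have tr : t * t = r by rewrite -expr2 sqr_sqrtr.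
have t1 : t < 1 by nra.
have bnd n : n%:R * t ^+ n * (1 - t) <= 1 - t ^+ n.
  elim: n => [|n IH]; first by rewrite !mul0r expr0 subrr.
  have tn0 : 0 <= t ^+ n by exact: exprn_ge0.
  have tn1 : t ^+ n <= 1 by apply: exprn_ile1 => //; exact: ltW.
  rewrite exprS -natr1.
  have n0 : 0 <= n%:R :> R by [].
  have := ler_wpM2l t0 IH.
  have : t * t ^+ n * (1 - t) <= 1 - t.
    by apply: ler_piMl; [lra|rewrite mulr_ile1//; lra].
  by nra.
apply: (@squeeze_cvgr _ _ _ _ (fun=> 0) (fun n => (1 - t)^-1 * t ^+ n)).
- apply: nearW => n; rewrite mulr_ge0//= ?exprn_ge0//.
  rewrite ler_pdivlMl ?subr_gt0// -tr exprMn.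
  have tn0 : 0 <= t ^+ n by exact: exprn_ge0.
  have /(ler_wpM2r tn0) := bnd n; have : 0 <= t ^+ n * t ^+ n by exact: mulr_ge0.
  by nra.
- exact: cvg_cst.
- rewrite -[X in _ --> X](mulr0 (1 - t)^-1); apply: cvgM; first exact: cvg_cst.
  by apply: cvg_expr; rewrite ger0_norm.
Qed.

Lemma cvg_step_poly_lt s : 0 <= s -> s < 2^-1 -> step_poly n s @[n --> \oo] --> (1 : R).
Proof.
move=> s0 s2.
have h : forall n, 1 - n%:R * (2 * s) ^+ n <= step_poly n s <= 1.
  move=> n; rewrite /step_poly; have s01 : 0 <= s ^+ n <= 1.
    by rewrite exprn_ge0//= exprn_ile1//; lra.
  have /andP[_ ->] : 0 <= step_poly n s <= 1 by apply: step_poly_itv; lra.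
  rewrite andbT; apply: le_trans (bernoulli_le _ s01).
  by rewrite exprMn natrM natrX mulrA.
apply: (@squeeze_cvgr _ _ _ _ (fun n => 1 - n%:R * (2 * s) ^+ n) (fun=> 1)).
- exact: nearW.
- rewrite -[X in _ --> X]subr0; apply: cvgB; first exact: cvg_cst.
  by apply: cvg_natM_geometric; lra.
- exact: cvg_cst.
Qed.

Lemma cvg_step_poly_ge s : 2^-1 <= s <= 1 -> step_poly n s @[n --> \oo] --> (0 : R).
Proof.
move=> /andP[s2 s1].
have h n : 0 <= step_poly n s <= 2^-1 ^+ n.
  have /andP[-> _] : 0 <= step_poly n s <= 1 by apply: step_poly_itv; lra.
  rewrite /= /step_poly mulnC exprM; apply: lerXn2r; rewrite ?nnegrE.
  - by rewrite exprn_ge0// subr_ge0 exprn_ile1//; lra.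
  - by lra.
  apply: le_trans (step_poly_base_le n); apply: lerXn2r; rewrite ?nnegrE.
  - by rewrite subr_ge0 exprn_ile1//; lra.
  - by rewrite subr_ge0 exprn_ile1//; lra.
  by rewrite lerB// lerXn2r// ?nnegrE; lra.
apply: (@squeeze_cvgr _ _ _ _ (fun=> 0) (fun n => 2^-1 ^+ n)).
- exact: nearW.
- exact: cvg_cst.
- by apply: cvg_expr; rewrite ger0_norm; lra.
Qed.

End StepPolynomials.

(** * A Stone-Weierstrass theorem for square integrable functions *)

Section StoneWeierstrass.
Context d (T : measurableType d) (R : realType).
Variables (mu : {measure set T -> \bar R}) (D : set T) (w : T -> R).
Implicit Types (V A : set (T -> R)) (f g h : T -> R) (B : set T).

Definition linear_set V := forall (a : R) f g, V f -> V g -> V (fun x => a * f x + g x).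

Lemma linear_set0 V f : linear_set V -> V f -> V (fun=> 0).
Proof. by move=> lV Vf; have := lV (-1) _ _ Vf Vf; congr (V _); apply/funext => x; ring. Qed.

Lemma linear_setZ V (a : R) f : linear_set V -> V f -> V (fun x => a * f x).
Proof.
move=> lV Vf; have := lV a _ _ Vf (linear_set0 lV Vf).
by congr (V _); apply/funext => x; ring.
Qed.

Lemma linear_setD V f g : linear_set V -> V f -> V g -> V (fun x => f x + g x).
Proof. by move=> lV Vf Vg; have := lV 1 _ _ Vf Vg; congr (V _); apply/funext => x; ring. Qed.

Lemma linear_setB V f g : linear_set V -> V f -> V g -> V (fun x => f x - g x).
Proof. by move=> lV Vf Vg; have := lV (-1) _ _ Vg Vf; congr (V _); apply/funext => x; ring. Qed.

(** Closedness in L2 (w mu), phrased through pointwise convergence and a dominating function,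
so that the same definition serves spaces of functions on the line and on the plane. *)
Definition dominated_closed V := forall (g_ : nat -> T -> R) f h,
  (forall n, V (g_ n)) -> measurable_fun setT f ->
  (forall x, D x -> g_ n x @[n --> \oo] --> f x) ->
  mu.-integrable D (EFin \o h) ->
  (forall n x, D x -> (f x - g_ n x) ^+ 2 * w x <= h x) -> V f.

Definition bounded_algebra A := [/\ A (fun=> 1), linear_set A,
  (forall f g, A f -> A g -> A (fun x => f x * g x)) &
  (forall f, A f -> exists K, forall x, `|f x| <= K)].

(** The sets whose indicator is, on [D], a pointwise limit of elements of [A] with values in
[0, 1]. Asking nothing outside [D] allows a set to be replaced by its trace on [D]. *)
Definition bounded_limit A B := measurable B /\
  exists g_ : nat -> T -> R, [/\ forall n, A (g_ n),
    forall n x, D x -> 0 <= g_ n x <= 1 &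
    forall x, D x -> g_ n x @[n --> \oo] --> (\1_B x : R)].

Lemma bounded_algebraX A f n : bounded_algebra A -> A f -> A (fun x => f x ^+ n).
Proof.
move=> [A1 _ AM _] Af; elim: n => [//|n IH].
rewrite (_ : (fun _ => _) = (fun x => f x * f x ^+ n)); first exact: AM.
by apply/funext => x; rewrite exprS.
Qed.

(** Products of the approximating sequences approximate the indicator of the intersection; this
is where the algebra structure provides the pi-system of Dynkin's lemma. *)
Lemma bounded_limitI A : bounded_algebra A -> setI_closed (bounded_limit A).
Proof.
move=> [A1 Al AM Ab] B1 B2 [mB1 [g1 [Ag1 g1b g1c]]] [mB2 [g2 [Ag2 g2b g2c]]].
split; first exact: measurableI.
exists (fun n x => g1 n x * g2 n x); split.
- by move=> n; exact: AM.
- move=> n x Dx; have /andP[? ?] := g1b n x Dx; have /andP[? ?] := g2b n x Dx.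
  by rewrite mulr_ge0//= mulr_ile1.
- by move=> x Dx; rewrite indicI; apply: cvgM; [exact: g1c|exact: g2c].
Qed.

(** An affine change of variable sends the range of f into [0, 1] and the value 0 to 1/2, where
[step_poly] jumps. *)
Lemma bounded_limit_pos A f B : bounded_algebra A -> A f -> measurable B ->
  (forall x, D x -> B x <-> 0 < f x) -> bounded_limit A B.
Proof.
move=> AA Af mB Bf; have [A1 Al AM Ab] := AA; split => //.
have [K fK] := Ab _ Af.
(* adding 1 makes M positive even when f vanishes *)
pose M : R := `|K| + 1.
have M0 : 0 < M by rewrite /M; have := normr_ge0 K; lra.
have fM x : - M <= f x <= M.
  by rewrite -ler_norml; apply: (le_trans (fK x)); rewrite /M; have := ler_norm K; lra.
pose s x : R := - (2 * M)^-1 * f x + 2^-1 * 1.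
have As : A s by apply: (Al _ _ (fun x => 2^-1 * 1)) => //;
  have := Al (2^-1 - 1) _ _ A1 A1; congr (A _); apply/funext => x; ring.
have sE x : s x = (M - f x) / (2 * M) by rewrite /s; field; rewrite gt_eqF.
have s01 x : 0 <= s x <= 1.
  have /andP[h1 h2] := fM x.
  rewrite sE divr_ge0/= ?ler_pdivrMr ?mulr_gt0//; lra.
exists (fun n x => step_poly n (s x)); split.
- move=> n; apply: (@bounded_algebraX A (fun x => 1 - s x ^+ n)) => //.
  rewrite (_ : (fun _ => _) = (fun x => (-1) * s x ^+ n + 1)).
    by apply: (Al _ (fun x => s x ^+ n) (fun=> 1)) => //; exact: bounded_algebraX.
  by apply/funext => x; ring.
- by move=> n x _; exact: step_poly_itv.
- move=> x Dx; rewrite indicE; have [Bx|Bx] := boolP (x \in B).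
    apply: cvg_step_poly_lt; first by have /andP[] := s01 x.
    have /Bf -/(_ Dx) fx : B x by rewrite inE in Bx.
    by rewrite sE ltr_pdivrMr ?mulr_gt0//; lra.
  apply: cvg_step_poly_ge; have /andP[_ ->] := s01 x; rewrite andbT.
  have fx : f x <= 0.
    rewrite leNgt; apply/negP => /(Bf _ Dx) Bx'; move: Bx; by rewrite mem_set.
  by rewrite sE ler_pdivlMr ?mulr_gt0//; lra.
Qed.

Hypothesis mD : measurable D.
Hypothesis w0 : forall x, 0 <= w x.
Hypothesis iw : mu.-integrable D (EFin \o w).
Variables (A V : set (T -> R)).
Hypothesis Aalg : bounded_algebra A.
Hypothesis AV : A `<=` V.
Hypothesis Vlin : linear_set V.
Hypothesis Vdom : dominated_closed V.
Hypothesis Agen : @measurable _ T `<=` <<s bounded_limit A >>.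

Lemma uniformly_bounded_closed (g_ : nat -> T -> R) f K : (forall n, V (g_ n)) ->
  measurable_fun setT f -> (forall n x, D x -> `|g_ n x| <= K) ->
  (forall x, D x -> g_ n x @[n --> \oo] --> f x) -> V f.
Proof.
move=> Vg mf gK gf; apply: (Vdom (h := fun x => (K + K) ^+ 2 * w x) Vg mf gf).
  rewrite (_ : EFin \o _ = (fun x => ((K + K) ^+ 2)%:E * (EFin \o w) x)%E) //.
  exact: integrableZl.
move=> n x Dx; apply: ler_wpM2r => //.
have fK : `|f x| <= K.
  have c : `|g_ n x| @[n --> \oo] --> `|f x| by apply: cvg_norm; exact: gf.
  by rewrite -(cvg_lim _ c)//; apply: limr_le; [exact: cvgP c|apply: nearW => m; exact: gK].
rewrite -(@real_normK _ (f x - _)) ?num_real// lerXn2r ?nnegrE//.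
  by rewrite addr_ge0// (le_trans _ (gK n x Dx)).
by rewrite (le_trans (ler_normB _ _))// lerD// gK.
Qed.

Lemma closed_one : V (fun=> 1).
Proof. by apply: AV; have [] := Aalg. Qed.

Lemma indic_bounded B x : `|\1_B x : R| <= 1.
Proof. by rewrite indicE; case: (_ \in _); rewrite ?normr1 ?normr0. Qed.

Lemma closed_indic B : measurable B -> V (\1_B : T -> R).
Proof.
move=> mB; have := Agen mB; move: mB => _; move: B.
have sG : @measurable _ T = <<s bounded_limit A >>.
  apply/seteqP; split; first exact: Agen.
  by apply: smallest_sub; [exact: sigma_algebra_measurable|move=> B []].
apply: (@dynkin_induction _ T (bounded_limit A) (fun B => V (\1_B : T -> R))) => //.
- exact: bounded_limitI.
- by have := closed_one; congr (V _); apply/funext => x; rewrite indicT.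
- move=> B [mB [g_ [Ag gb gc]]].
  apply: (@uniformly_bounded_closed g_ _ 1) => //.
  + by move=> n; exact: AV.
  + by move=> n x Dx; have /andP[? ?] := gb n x Dx; rewrite ger0_norm.
- move=> B mB VB1.
  rewrite (_ : (\1_(~` B) : T -> R) = (fun x => 1 - \1_B x));
    first exact: linear_setB Vlin closed_one VB1.
  apply/funext => x; rewrite !indicE in_setC.
  by case: (x \in B); rewrite ?subrr ?subr0.
- move=> F mF tF VF.
  (* finite unions are reached by linearity, and increase to the whole union *)
  pose S n := \bigcup_(k in `I_n) F k.
  have VS n : V (\1_(S n) : T -> R).
    elim: n => [|n IH].
      by have := linear_set0 Vlin closed_one; congr (V _); apply/funext => x;
        rewrite /S II0 bigcup_set0 indic0.
    have := linear_setD Vlin IH (VF n); congr (V _); apply/funext => x.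
    have -> : S n.+1 = S n `|` F n.
      by rewrite /S IIS bigcup_setU bigcup_set1.
    rewrite !indicE in_setU.
    have [xS|//] := boolP (x \in S n); rewrite ?add0r//.
    have [xF|] := boolP (x \in F n); last by rewrite orbF addr0.
    exfalso; move: xS xF; rewrite !inE => -[k /= kn Fk] Fn.
    have kn' : k = n by apply: tF => //; exists x.
    by rewrite kn' ltnn in kn.
  apply: (@uniformly_bounded_closed (fun n => \1_(S n)) _ 1) => //.
  + by apply: measurable_indic; exact: bigcup_measurable.
  + by move=> n x _; exact: indic_bounded.
  + move=> x _; have [[k _ Fk]|nF] := pselect ((\bigcup_k F k) x).
      apply: cvg_near_cst; exists k.+1 => //= n /= kn.
      by rewrite !indicE !mem_set//; [exists k|exists k].
    apply: cvg_near_cst; apply: nearW => n.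
    rewrite !indicE !memNset// => -[k _ Fk]; apply: nF; by exists k.
Qed.

Import HBNNSimple.

Lemma closed_nnsfun (g : {nnsfun T >-> R}) : V g.
Proof.
pose s := finmap.enum_fset (fset_set (range g)).
have -> : (g : T -> R) = (fun x => \sum_(y <- s) y * \1_(g @^-1` [set y]) x).
  by apply/funext => x; rewrite fimfunE fsbig_finite//; exact: fimfunP.
elim: s => [|y s' IH].
  by have := linear_set0 Vlin closed_one; congr (V _); apply/funext => x; rewrite big_nil.
under eq_fun do rewrite big_cons.
by apply: Vlin IH; apply: closed_indic; exact: measurable_sfunP.
Qed.

Lemma closed_nonneg f : measurable_fun setT f -> (forall x, 0 <= f x) ->
  mu.-integrable D (fun x => (f x ^+ 2 * w x)%:E) -> V f.
Proof.
move=> mf f0 fi.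
have mf' : measurable_fun setT (EFin \o f) by exact/measurable_EFinP.
pose g_ := nnsfun_approx measurableT mf'.
have gf x : g_ n x @[n --> \oo] --> f x.
  have : EFin \o g_^~ x @ \oo --> (EFin \o f) x.
    by apply: cvg_nnsfun_approx => // y _; rewrite lee_fin.
  by move/fine_cvgP => [].
apply: (@Vdom g_ f (fun x => f x ^+ 2 * w x)) => // [n|n x Dx]; first exact: closed_nnsfun.
apply: ler_wpM2r => //.
have g0 : 0 <= g_ n x by [].
have gle : g_ n x <= f x.
  rewrite -(cvg_lim _ (gf x))//; apply: nondecreasing_cvgn_le; last exact: cvgP (gf x).
  by move=> m k mk; have /lefP := nd_nnsfun_approx measurableT mf' mk; exact.
by rewrite lerXn2r ?nnegrE; lra.
Qed.

(** A measure-theoretic form of the Stone-Weierstrass theorem: separation of points is replaced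
by generation of the sigma-algebra, and uniform limits by dominated ones. Applied to a closed
subspace V of L2 (w mu), it says that V is everything. *)
Theorem dense_of_generating_algebra f : measurable_fun setT f ->
  mu.-integrable D (fun x => (f x ^+ 2 * w x)%:E) -> V f.
Proof.
move=> mf fi.
have mw : measurable_fun D w by have /integrableP[/measurable_EFinP] := iw.
have part g : measurable_fun setT g -> (forall x, 0 <= g x <= `|f x|) -> V g.
  move=> mg gf; apply: closed_nonneg => // [x|]; first by have /andP[] := gf x.
  apply: le_integrable fi => //.
    apply/measurable_EFinP; apply: measurable_funM => //.
    by apply: measurable_funX; exact: measurable_funTS.
  move=> x Dx /=; have /andP[g0 gl] := gf x.
  have sw0 (u : R) : 0 <= u ^+ 2 * w x by apply: mulr_ge0 => //; exact: sqr_ge0.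
  rewrite lee_fin (ger0_norm (sw0 _)) (ger0_norm (sw0 _)).
  by apply: ler_wpM2r => //; rewrite -[leRHS]real_normK ?num_real// lerXn2r ?nnegrE.
have -> : f = (fun x => Num.max (f x) 0 - Num.max (- f x) 0).
  by apply/funext => x; case: (leP (f x) 0) => h; case: (leP (- f x) 0) => h'; lra.
apply: linear_setB => //; apply: part.
- exact: measurable_maxr.
- by move=> x; rewrite le_max lexx orbT ge_max ler_norm normr_ge0.
- by apply: measurable_maxr => //; exact: measurableT_comp.
- by move=> x; rewrite le_max lexx orbT ge_max -normrN ler_norm normr_ge0.
Qed.

End StoneWeierstrass.

(** * Integrals against a Gaussian *)

Section GaussianIntegrals.
Context {R : realType}.
Local Notation mu := (@lebesgue_measure R).
Implicit Types (a c y : R) (p q : {poly R}).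

Definition gauss a c y : R := expR (- (a * y + c) ^+ 2).

Lemma gauss_ge0 a c y : 0 <= gauss a c y. Proof. exact: expR_ge0. Qed.

Lemma gaussE a c : gauss a c = expR \o horner (- (a%:P * 'X + c%:P) ^+ 2).
Proof. by apply/funext => y; rewrite /gauss /= !hornerE. Qed.

Lemma measurable_gauss a c : measurable_fun setT (gauss a c).
Proof.
rewrite gaussE; apply: measurableT_comp => //.
by apply: continuous_measurable_fun; exact: continuous_horner.
Qed.

Lemma integral_gauss a c : 0 < a ->
  (\int[mu]_y (gauss a c y)%:E)%E = (Num.sqrt pi / a)%:E /\
  mu.-integrable setT (EFin \o gauss a c).
Proof.
(* mean and standard deviation of the normal law whose density is proportional to gauss a c *)
move=> a0; pose m : R := - c / a; pose s : R := (a * Num.sqrt 2)^-1.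
have s2 : s ^+ 2 = (a ^+ 2 * 2)^-1 by rewrite /s exprVn exprMn sqr_sqrtr.
have sn0 : s != 0.
  by rewrite /s invr_eq0 mulf_neq0// gt_eqF// sqrtr_gt0.
have gE : EFin \o gauss a c = (fun y => (normal_peak s)^-1%:E * (normal_pdf m s y)%:E)%E.
  apply/funext => y /=; rewrite normal_pdfE// -EFinM; congr EFin.
  rewrite mulKf ?gt_eqF ?normal_peak_gt0//; congr expR.
  by rewrite s2 /m; field; rewrite gt_eqF.
have peak : (normal_peak s)^-1 = Num.sqrt pi / a.
  rewrite /normal_peak invrK s2.
  rewrite (_ : (_ * _ *+ 2) = pi * (a^-1) ^+ 2).
    by rewrite sqrtrM ?pi_ge0// sqrtr_sqr ger0_norm// invr_ge0 ltW.
  by rewrite -mulr_natr; field; rewrite gt_eqF.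
have inorm := integrable_normal_pdf m s.
split; last by rewrite gE; exact: integrableZl.
rewrite -[LHS]/(\int[mu]_y (EFin \o gauss a c) y)%E gE integralZl//.
by rewrite integral_normal_pdf mule1 peak.
Qed.

Definition exp_growth (f : R -> R) :=
  exists K B : R, forall y, `|f y| <= K * expR (B * `|y|).

(** Completing squares: a part of the quadratic exponent absorbs any factor of exponential growth
and any shift. *)
Lemma exp_growth_gauss a c (f : R -> R) : 0 < a -> exp_growth f ->
  exists2 M : R, 0 <= M & forall y, `|f y| * gauss a c y <= M * gauss (a / 2) 0 y.
Proof.
move=> a0 [K [B fKB]].
exists (`|K| * expR (c ^+ 2 + B ^+ 2 / a ^+ 2)); first by rewrite mulr_ge0// expR_ge0.
move=> y; apply: (@le_trans _ _ (`|K| * expR (B * `|y|) * gauss a c y)).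
  apply: ler_wpM2r; first exact: gauss_ge0.
  apply: (le_trans (fKB y)); apply: ler_wpM2r; first exact: expR_ge0.
  exact: ler_norm.
rewrite -!mulrA; apply: ler_wpM2l => //; rewrite /gauss -!expRD ler_expR.
have y2 : y ^+ 2 = `|y| ^+ 2 by rewrite real_normK ?num_real.
have h1 : 0 <= (a * `|y| / 2 - B / a) ^+ 2 by exact: sqr_ge0.
have h2 : 0 <= (a * y + 2 * c) ^+ 2 by exact: sqr_ge0.
have e1 : (a * `|y| / 2 - B / a) ^+ 2 = a ^+ 2 / 4 * y ^+ 2 - B * `|y| + B ^+ 2 / a ^+ 2.
  by rewrite y2; field; rewrite gt_eqF.
have e2 : (a * y + 2 * c) ^+ 2 = a ^+ 2 * y ^+ 2 + 4 * (a * c * y) + 4 * c ^+ 2 by ring.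
have e3 : (a * y + c) ^+ 2 = a ^+ 2 * y ^+ 2 + 2 * (a * c * y) + c ^+ 2 by ring.
have e4 : (a / 2 * y + 0) ^+ 2 = a ^+ 2 / 4 * y ^+ 2 by field.
rewrite e3 e4; lra.
Qed.

Lemma integrable_gauss_growth a c (f : R -> R) : 0 < a -> measurable_fun setT f ->
  exp_growth f -> mu.-integrable setT (fun y => (f y * gauss a c y)%:E).
Proof.
move=> a0 mf /(exp_growth_gauss c a0)[M M0 fM].
have a20 : 0 < a / 2 by lra.
have [_ ig] := integral_gauss 0 a20.
have iMg := integrableZl measurableT M ig.
apply: le_integrable iMg => //.
  by apply/measurable_EFinP; apply: measurable_funM => //; exact: measurable_gauss.
move=> y _ /=; rewrite lee_fin normrM (ger0_norm (gauss_ge0 _ _ _)).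
by rewrite (le_trans (fM y))// ler_norm.
Qed.

Lemma exp_growth_cst (k : R) : exp_growth (fun=> k).
Proof. by exists `|k|, 0 => y; rewrite mul0r expR0 mulr1. Qed.

Lemma exp_growthM f g : exp_growth f -> exp_growth g -> exp_growth (fun y => f y * g y).
Proof.
move=> [K [B fKB]] [L [C gLC]]; exists (K * L), (B + C) => y.
by rewrite normrM mulrDl expRD mulrACA ler_pM.
Qed.

Lemma exp_growthD f g : exp_growth f -> exp_growth g -> exp_growth (fun y => f y + g y).
Proof.
move=> [K [B fKB]] [L [C gLC]]; exists (`|K| + `|L|), (`|B| + `|C|) => y.
have widen (k b e : R) : 0 <= e -> k * expR (b * `|y|) <= `|k| * expR ((`|b| + e) * `|y|).
  move=> e0; apply: (@le_trans _ _ (`|k| * expR (b * `|y|))).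
    by apply: ler_wpM2r; [exact: expR_ge0|exact: ler_norm].
  apply: ler_wpM2l => //; rewrite ler_expR; apply: ler_wpM2r => //.
  by rewrite (le_trans (ler_norm _))// lerDl.
apply: (le_trans (ler_normD _ _)); rewrite (mulrDl `|K|); apply: lerD.
  exact: le_trans (fKB y) (widen _ _ _ _).
by rewrite (addrC `|B|); exact: le_trans (gLC y) (widen _ _ _ _).
Qed.

Lemma exp_growth_id : exp_growth id.
Proof.
exists 1, 1 => y; rewrite !mul1r; have := expR_ge1Dx `|y|; lra.
Qed.

Lemma exp_growth_expR (t : R) : exp_growth (fun y => expR (t * y)).
Proof.
exists 1, `|t| => y; rewrite mul1r ger0_norm ?expR_ge0// ler_expR.
by rewrite -normrM ler_norm.
Qed.

Lemma exp_growth_horner p : exp_growth (horner p).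
Proof.
elim/poly_ind: p => [|p k IH].
  by rewrite horner0_ext; exact: exp_growth_cst.
rewrite (_ : horner _ = fun y => p.[y] * y + k).
  by apply: exp_growthD; [exact: exp_growthM exp_growth_id|exact: exp_growth_cst].
by apply/funext => y; rewrite !hornerE.
Qed.

Lemma measurable_horner p : measurable_fun setT (horner p : R -> R).
Proof. by apply: continuous_measurable_fun; exact: continuous_horner. Qed.

Lemma measurable_expR_linear (t : R) : measurable_fun setT (fun y : R => expR (t * y)).
Proof. by apply: measurableT_comp => //; exact: measurable_funM. Qed.

Lemma is_derive_horner_expR p q y :
  is_derive y 1 (fun t => p.[t] * expR q.[t]) ((p^`() + p * q^`()).[y] * expR q.[y]).
Proof.
apply: (@trigger_derive _ (horner p * (expR \o horner q))).
rewrite !hornerE /GRing.scale /=; ring.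
Qed.

Lemma continuous_horner_expR p q : continuous (fun t => p.[t] * expR q.[t] : R).
Proof.
move=> y; apply/differentiable_continuous; apply/derivable1_diffP.
by have [] := is_derive_horner_expR p q y.
Qed.

(** The integrand is the derivative of p e^(-(a y + c)^2), which vanishes at both infinities. *)
Lemma integral_deriv_gauss p a c : 0 < a ->
  (\int[mu]_y ((p^`() - (2 * a) *: (a%:P * 'X + c%:P) * p).[y] * gauss a c y)%:E)%E = 0%E.
Proof.
move=> a0; set r := (_ - _).
set q : {poly R} := - (a%:P * 'X + c%:P) ^+ 2.
have rE : r = p^`() + p * q^`().
  rewrite /r /q derivN expr2 derivM derivD derivM !derivC derivX.
  rewrite -mul_polyC rmorphM/= rmorph_nat; ring.
pose F y := p.[y] * expR q.[y].
pose f y := r.[y] * expR q.[y].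
have fE : (fun y => r.[y] * gauss a c y) = f by rewrite gaussE.
have dF y : is_derive y 1 F (f y) by rewrite /f rE; exact: is_derive_horner_expR.
have cF : continuous F by exact: continuous_horner_expR.
have cf : continuous f by exact: continuous_horner_expR.
have fi : mu.-integrable setT (EFin \o f).
  rewrite -fE; apply: integrable_gauss_growth => //; first exact: measurable_horner.
  exact: exp_growth_horner.
(* the integral over R is computed along the symmetric intervals J n *)
pose J (n : nat) : set R := `[- (n.+1%:R : R), n.+1%:R]%classic.
have FTC (n : nat) : (\int[mu]_(y in J n) (f y)%:E)%E = (F n.+1%:R - F (- n.+1%:R))%:E.
  have nn : - n.+1%:R < n.+1%:R :> R by rewrite gtrN.
  rewrite (@continuous_FTC2 _ f F)//.
  - by apply: continuous_subspaceT.
  - split; first by move=> y _; have [] := dF y.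
    + by apply: cvg_at_right_filter; exact: cF.
    + by apply: cvg_at_left_filter; exact: cF.
  - by move=> y _; rewrite derive1E; have [_ ->] := dF y.
have F0 (u : nat -> R) : (forall n, `|u n| = n.+1%:R) -> F (u n) @[n --> \oo] --> (0 : R).
  move=> un.
  have [] := @exp_growth_gauss a c (fun y => p.[y] * expR (1 * `|y|)) a0.
    apply: exp_growthM; first exact: exp_growth_horner.
    by exists 1, 1 => y; rewrite !mul1r ger0_norm ?expR_ge0.
  move=> M M0 bnd.
  have FM y : `|F y| <= M * expR (- `|y|).
    have := bnd y; rewrite gaussE /= -/q mul1r normrM (ger0_norm (expR_ge0 _)).
    rewrite /F normrM (ger0_norm (expR_ge0 _)) expRN ler_pdivlMr ?expR_gt0//.
    rewrite mulrAC; move/le_trans; apply.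
    by apply: ler_piMr => //; rewrite /gauss -expR0 ler_expR oppr_le0 sqr_ge0.
  apply/norm_cvg0P.
  apply: (@squeeze_cvgr _ _ _ _ (fun=> 0) (fun n => M * expR (- n.+1%:R))).
  - by apply: nearW => n; rewrite normr_ge0/= -un.
  - exact: cvg_cst.
  - rewrite -[X in _ --> X](mulr0 M); apply: cvgM; first exact: cvg_cst.
    by rewrite (cvg_shiftS (fun n => expR (- n%:R))); exact: cvgn_expR.
have lim0 : (\int[mu]_(y in J n) (f y)%:E)%E @[n --> \oo] --> 0%E.
  rewrite (_ : (fun n => _) = (fun n : nat => (F n.+1%:R - F (- n.+1%:R))%:E)); last exact/funext.
  apply: cvg_EFin; first exact: nearW.
  rewrite -[X in _ --> X](subr0 0); apply: cvgB; apply: F0 => n; first by rewrite normr_nat.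
  by rewrite normrN normr_nat.
have lim : (\int[mu]_(y in J n) (f y)%:E)%E @[n --> \oo] --> (\int[mu]_y (f y)%:E)%E.
  under eq_fun do rewrite integral_mkcond.
  have [] := @dominated_convergence _ _ _ mu setT measurableT
    (fun n : nat => (EFin \o f) \_ (J n)) (EFin \o f) (abse \o (EFin \o f)).
  - move=> n; apply/(measurable_restrictT _ _).1 => //.
      exact: measurable_itv.
    by apply: measurable_funTS; have /integrableP[] := fi.
  - by have /integrableP[] := fi.
  - apply: aeW => y _; apply: cvg_near_cst; near=> n.
    rewrite patchE mem_set//= /J /= in_itv/= -ler_norml.
    near: n; exists (Num.truncn `|y|) => //= n /= yn.
    by apply: ltW; rewrite (lt_le_trans (truncnS_gt _))// ler_nat.
  - exact: integrable_abse.
  - apply: aeW => y n _; rewrite patchE; case: ifP => _ //=.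
    by rewrite normr0 lee_fin.
  - by move=> _ _; exact.
rewrite (_ : (fun y => _) = EFin \o f); last by rewrite -fE.
exact: cvg_unique lim lim0.
Unshelve. all: by end_near. Qed.

End GaussianIntegrals.

(** * Hermite polynomials *)

Section HermitePolynomials.
Context {R : realType}.
Local Notation mu := (@lebesgue_measure R).
Implicit Types (a c : R) (p q : {poly R}).

(** The recurrence read off the Rodrigues formula: differentiating P e^(-X^2) replaces P by
P' - 2 X P, and the factor (-1)^n reverses the sign at each step. *)
Fixpoint hermite_poly (n : nat) : {poly R} :=
  if n is m.+1 then 2 *: ('X * hermite_poly m) - (hermite_poly m)^`() else 1.

Lemma hermiteE n (x : R) : hermite n x = (hermite_poly n).[x].
Proof.
pose e (t : R) : R := expR (- t ^+ 2).
have eE t : e t = expR (- 'X^2 : {poly R}).[t] by rewrite /e !hornerE.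
have dn : derive1n n e = fun t => ((-1) ^+ n *: hermite_poly n).[t] * e t.
  elim: n => [|n IH]; apply/funext => t.
    by rewrite derive1n0 expr0 scale1r /= hornerE mul1r.
  rewrite derive1nS IH derive1E.
  rewrite (_ : (fun _ => _) = fun t => ((-1) ^+ n *: hermite_poly n).[t] * expR (- 'X^2 : {poly R}).[t]); last first.
    by apply/funext => u; rewrite eE.
  have [_ ->] := is_derive_horner_expR ((-1) ^+ n *: hermite_poly n) (- 'X^2) t.
  rewrite -eE; congr (_ * _).
  rewrite derivZ derivN derivXn /= !(hornerD, hornerN, hornerZ, hornerM, hornerMn, hornerX) exprS.
  ring.
rewrite /hermite -/e dn /e hornerZ; set H := _.[x].
have s1 : (-1) ^+ n * (-1) ^+ n = 1 :> R by rewrite -exprMn mulrNN mulr1 expr1n.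
have e1 : expR (x ^+ 2) * expR (- x ^+ 2) = 1 by rewrite -expRD subrr expR0.
transitivity (((-1) ^+ n * (-1) ^+ n) * (expR (x ^+ 2) * expR (- x ^+ 2)) * H); first by ring.
by rewrite s1 e1 !mul1r.
Qed.

Lemma size_hermite_poly n : size (hermite_poly n) = n.+1.
Proof.
elim: n => [|n IH]; first by rewrite size_poly1.
have H0 : hermite_poly n != 0 by rewrite -size_poly_gt0 IH.
have sX : size (2 *: ('X * hermite_poly n)) = n.+2.
  by rewrite size_scale// mulrC size_mulX// IH.
rewrite [hermite_poly n.+1]/= size_polyDl// size_polyN sX ltnS.
by rewrite ltnW// -IH lt_size_deriv.
Qed.

Lemma deriv_hermite_poly n : (hermite_poly n.+1)^`() = (2 * n.+1)%:R *: hermite_poly n.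
Proof.
elim: n => [|n IH].
  by rewrite /= mulr1 derivB derivZ derivX derivC deriv0 subr0 muln1.
rewrite [in LHS](_ : hermite_poly n.+2 =
  2 *: ('X * hermite_poly n.+1) - (hermite_poly n.+1)^`()) //.
rewrite derivB derivZ derivM derivX mul1r IH derivZ.
rewrite [in RHS](_ : hermite_poly n.+1 = 2 *: ('X * hermite_poly n) - (hermite_poly n)^`()) //.
set H := hermite_poly n; set H1 := H^`().
rewrite /= -/H -/H1 -!mul_polyC !natrM !rmorphM /= !rmorph_nat !mulrS; ring.
Qed.

Lemma derivn_hermite_poly n : (hermite_poly n)^`(n) = (2 ^ n * n`!)%:R%:P.
Proof.
elim: n => [|n IH]; first by rewrite derivn0.
rewrite derivSn deriv_hermite_poly derivnZ IH -mul_polyC -polyCM -natrM.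
by congr (_%:R%:P); rewrite expnS factS; lia.
Qed.

(** The degrees of the Hermite polynomials are 0, 1, 2, ..., so they form a basis of the
polynomials. *)
Lemma hermite_poly_ind (P : {poly R} -> Prop) :
  P 0 -> (forall (k : R) p q, P p -> P q -> P (k *: p + q)) ->
  (forall n, P (hermite_poly n)) -> forall p, P p.
Proof.
move=> P0 Plin PH p; have [n] := ubnP (size p).
elim: n p => // n IH p; rewrite ltnS => pn.
have [->//|p0] := eqVneq p 0.
have sp : (0 < size p)%N by rewrite size_poly_gt0.
pose m := (size p).-1; have mE : size p = m.+1 by rewrite /m prednK.
(* subtracting k H_m removes the leading term of p *)
pose k := lead_coef p / lead_coef (hermite_poly m).
have H0 : lead_coef (hermite_poly m) != 0.
  by rewrite lead_coef_eq0 -size_poly_gt0 size_hermite_poly.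
rewrite (_ : p = k *: hermite_poly m + (p - k *: hermite_poly m)); last by rewrite addrC subrK.
apply: Plin => //; apply: IH.
apply: leq_trans pn; rewrite mE ltnS.
apply/leq_sizeP => j; rewrite leq_eqVlt => /predU1P[<-|mj].
  rewrite coefB coefZ; have := lead_coefE p; rewrite mE /= => <-.
  have := lead_coefE (hermite_poly m); rewrite size_hermite_poly /= => <-.
  by rewrite /k divfK// subrr.
by rewrite coefB coefZ !nth_default ?size_hermite_poly ?mE// mulr0 subr0.
Qed.

(** The pairing of p with the Gaussian of the variable a y + c, integrated in y as the inner
products over the strip are. *)
Definition gauss_mean a c p : R := (\int[mu]_y (p.[a * y + c] * gauss a c y))%R.

Lemma integrable_gauss_mean a c p : 0 < a ->
  mu.-integrable setT (EFin \o (fun y => p.[a * y + c] * gauss a c y)).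
Proof.
move=> a0; rewrite (_ : (fun y => _) = (fun y => (p \Po (a%:P * 'X + c%:P)).[y] * gauss a c y)).
  apply: integrable_gauss_growth => //; first exact: measurable_horner.
  exact: exp_growth_horner.
by apply/funext => y; rewrite horner_comp !hornerE.
Qed.

Lemma gauss_meanD a c p q : 0 < a ->
  gauss_mean a c (p + q) = gauss_mean a c p + gauss_mean a c q.
Proof.
move=> a0; rewrite -RintegralD//; [|exact: integrable_gauss_mean..].
by apply: eq_Rintegral => y _; rewrite hornerD mulrDl.
Qed.

Lemma gauss_meanZ a c k p : 0 < a -> gauss_mean a c (k *: p) = k * gauss_mean a c p.
Proof.
move=> a0; rewrite -RintegralZl//; last exact: integrable_gauss_mean.
by apply: eq_Rintegral => y _; rewrite hornerZ mulrA.
Qed.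

Lemma gauss_mean1 a c : 0 < a -> gauss_mean a c 1 = Num.sqrt pi / a.
Proof.
move=> a0; rewrite /gauss_mean /Rintegral.
rewrite (_ : (fun y => _) = EFin \o gauss a c); first by have [->] := integral_gauss c a0.
by apply/funext => y /=; rewrite hornerE mul1r.
Qed.

Lemma gauss_mean_deriv a c p : 0 < a ->
  gauss_mean a c p^`() = gauss_mean a c (2 *: ('X * p)).
Proof.
move=> a0; apply/eqP; rewrite -subr_eq0 -[X in _ - X]mul1r -mulNr -gauss_meanZ// -gauss_meanD//.
have := integral_deriv_gauss (p \Po (a%:P * 'X + c%:P)) c a0.
set L := (a%:P * 'X + c%:P); set D := (p^`() + _).
have -> : (p \Po L)^`() - (2 * a) *: L * (p \Po L) = a *: (D \Po L).
  rewrite deriv_comp /D rmorphD /= !linearZ /= rmorphM /= comp_polyX.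
  rewrite (_ : L^`() = a%:P); last by rewrite /L derivD derivM !derivC derivX; ring.
  rewrite -!mul_polyC !rmorphM /= rmorph_nat rmorphN1; ring.
move=> H; have : gauss_mean a c (a *: D) = 0.
  rewrite -[RHS]/(fine 0%E) -H /gauss_mean /Rintegral; congr fine.
  by apply: eq_integral => y _; rewrite !hornerZ horner_comp /L !hornerE.
rewrite gauss_meanZ// => /eqP; rewrite mulf_eq0 gt_eqF//=.
Qed.

(** Integration by parts, n times: the derivative of H_m q e^(-X^2) is
(H_m q' - H_(m+1) q) e^(-X^2), and it integrates to 0. *)
Lemma gauss_mean_hermite a c n q : 0 < a ->
  gauss_mean a c (hermite_poly n * q) = gauss_mean a c q^`(n).
Proof.
move=> a0; elim: n q => [|n IH] q; first by rewrite derivn0 mul1r.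
rewrite derivSn -IH.
have := gauss_mean_deriv c (hermite_poly n * q) a0; rewrite derivM gauss_meanD// => /eqP.
rewrite addrC -subr_eq0 => /eqP E.
apply/esym/eqP; rewrite -subr_eq0 -E; apply/eqP.
set H := hermite_poly n.
rewrite [hermite_poly n.+1]/= -/H mulrBl.
rewrite -[X in _ - X]mul1r -mulNr -gauss_meanZ// scaleN1r opprB gauss_meanD//.
rewrite -scalerAl -mulrA -scaleN1r (gauss_meanZ _ (-1))//; ring.
Qed.

Lemma gauss_mean_orthogonal a c j k : 0 < a ->
  gauss_mean a c (hermite_poly j * hermite_poly k) =
  (j == k)%:R * (2 ^ j * j`!)%:R * (Num.sqrt pi / a).
Proof.
(* by symmetry the polynomial differentiated has the smaller degree *)
move=> a0; wlog jk : j k / (k <= j)%N.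
  move=> wl; have /orP[h|h] := leq_total k j; first exact: wl.
  by rewrite mulrC wl// eq_sym; case: eqP => [->//|_]; rewrite !mul0r.
rewrite gauss_mean_hermite//; have [jkE|jk'] := eqVneq j k.
  by rewrite jkE derivn_hermite_poly -alg_polyC gauss_meanZ// gauss_mean1// mul1r.
rewrite derivn_poly0; last by rewrite size_hermite_poly ltn_neqAle eq_sym jk'.
by rewrite -(scale0r 1) gauss_meanZ// !mul0r.
Qed.

End HermitePolynomials.

(** * Power series times a Gaussian *)

Section GaussianPowerSeries.
Context {R : realType}.
Local Notation leb := (@lebesgue_measure R).
Implicit Types (kappa phi : R -> R) (p : {poly R}).

(** Square integrability, in a form that is stable under multiplication by functions of
exponential growth. *)
Definition gauss_decay kappa := measurable_fun setT kappa /\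
  exists b d K B : R, 0 < b /\
    forall y, kappa y ^+ 2 <= K * expR (B * `|y|) * gauss b d y.

Lemma gauss_decay_integrable kappa : gauss_decay kappa ->
  leb.-integrable setT (EFin \o (fun y => kappa y ^+ 2)).
Proof.
move=> [mk [b [d [K [B [b0 kb]]]]]].
have ig : leb.-integrable setT (fun y => (K * expR (B * `|y|) * gauss b d y)%:E).
  apply: (@integrable_gauss_growth _ _ _ (fun y => K * expR (B * `|y|))) => //.
    apply: measurable_funM => //; apply: measurableT_comp => //.
    by apply: measurable_funM => //; exact: measurableT_comp.
  by exists `|K|, B => y; rewrite normrM (ger0_norm (expR_ge0 _)).
apply: le_integrable ig => //.
  by apply/measurable_EFinP; exact: measurable_funX.
by move=> y _ /=; rewrite lee_fin ger0_norm ?sqr_ge0// (le_trans (kb y))// ler_norm.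
Qed.

Lemma gauss_decayM phi kappa : measurable_fun setT phi -> exp_growth phi ->
  gauss_decay kappa -> gauss_decay (fun y => phi y * kappa y).
Proof.
move=> mphi [L [C phiL]] [mk [b [d [K [B [b0 kb]]]]]]; split; first exact: measurable_funM.
exists b, d, (L ^+ 2 * K), (2 * C + B); split => // y.
have p2 : phi y ^+ 2 <= L ^+ 2 * expR (2 * C * `|y|).
  rewrite -[leLHS]real_normK ?num_real//.
  rewrite (_ : _ * expR _ = (L * expR (C * `|y|)) ^+ 2).
    by rewrite lerXn2r// nnegrE// (le_trans (normr_ge0 _) (phiL y)).
  by rewrite exprMn -expRM_natl mulrA.
rewrite exprMn mulrDl expRD.
rewrite (_ : _ * gauss b d y = L ^+ 2 * expR (2 * C * `|y|) * (K * expR (B * `|y|) * gauss b d y)).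
  by apply: ler_pM => //; exact: sqr_ge0.
ring.
Qed.

Lemma series_exp_coeff_le (x : R) n : 0 <= x -> \sum_(0 <= j < n) x ^+ j / j`!%:R <= expR x.
Proof.
move=> x0; apply: (@nondecreasing_cvgn_le _ (series (exp_coeff x))).
  by apply: nondecreasing_series => k _ _; exact: exp_coeff_ge0.
exact: is_cvg_series_exp_coeff.
Qed.

Lemma power_series_growth (s : nat -> R) phi : (forall j, `|s j| <= (j`!%:R)^-1) ->
  (forall y, (\sum_(0 <= j < n) s j * y ^+ j) @[n --> \oo] --> phi y) ->
  (forall n y, `|\sum_(0 <= j < n) s j * y ^+ j| <= expR `|y|) /\
  (forall y, `|phi y| <= expR `|y|).
Proof.
move=> sb sphi.
have b n y : `|\sum_(0 <= j < n) s j * y ^+ j| <= expR `|y|.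
  apply: le_trans (series_exp_coeff_le n (normr_ge0 y)).
  apply: (le_trans (ler_norm_sum _ _ _)); apply: ler_sum => j _.
  rewrite normrM normrX mulrC; apply: ler_wpM2l => //; exact: exprn_ge0.
split => // y.
have cn : `|\sum_(0 <= j < n) s j * y ^+ j| @[n --> \oo] --> `|phi y|.
  by apply: cvg_norm; exact: sphi.
by rewrite -(cvg_lim _ cn)//; apply: limr_le; [exact: cvgP cn|exact: nearW].
Qed.

(** If U contains all polynomials times kappa, it contains all polynomials times
phi (t y) kappa (y): the partial sums of a series with coefficients at most 1 / j! are bounded
by exp (|t y|), and kappa decays fast enough to dominate their squares. Keeping an arbitrary
polynomial factor in the conclusion allows the lemma to be iterated. *)
Lemma power_series_mul (U : set (R -> R)) (s : nat -> R) (t : R) phi kappa :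
  linear_set U -> dominated_closed leb setT (fun=> 1) U ->
  (forall j, `|s j| <= (j`!%:R)^-1) ->
  (forall y, (\sum_(0 <= j < n) s j * y ^+ j) @[n --> \oo] --> phi y) ->
  measurable_fun setT phi -> gauss_decay kappa ->
  (forall p, U (fun y => p.[y] * kappa y)) ->
  forall p, U (fun y => p.[y] * (phi (t * y) * kappa y)).
Proof.
move=> lU dU sb sphi mphi gk Uk p.
have [Pb phib] := power_series_growth sb sphi.
have mk : measurable_fun setT kappa by case: gk.
pose P n := \poly_(j < n) (s j * t ^+ j).
have PE n y : (P n).[y] = \sum_(0 <= j < n) s j * (t * y) ^+ j.
  rewrite horner_poly big_mkord; apply: eq_bigr => j _; rewrite exprMn; ring.
have gd : gauss_decay (fun y => 2 * expR (`|t| * `|y|) * p.[y] * kappa y).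
  apply: gauss_decayM => //.
    apply: measurable_funM; last exact: measurable_horner.
    apply: measurable_funM => //; apply: measurableT_comp => //.
    by apply: measurable_funM => //; exact: measurableT_comp.
  apply: exp_growthM; last exact: exp_growth_horner.
  by exists 2, `|t| => y; rewrite ger0_norm// mulr_ge0// expR_ge0.
apply: (dU (fun n y => (p * P n).[y] * kappa y) _
  (fun y => (2 * expR (`|t| * `|y|) * p.[y] * kappa y) ^+ 2)).
- by move=> n; exact: Uk.
- apply: measurable_funM; first exact: measurable_horner.
  apply: measurable_funM => //; exact: measurableT_comp.
- move=> y _; under eq_fun do rewrite hornerM PE -mulrA.
  apply: cvgM; first exact: cvg_cst.
  by apply: cvgM; [exact: sphi|exact: cvg_cst].
- exact: gauss_decay_integrable.
move=> n y _; rewrite mulr1 hornerM PE.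
set Q := \sum_(0 <= j < n) _.
have h : `|phi (t * y) - Q| <= 2 * expR (`|t| * `|y|).
  rewrite -normrM; apply: (le_trans (ler_normB _ _)).
  by rewrite mulr_natl mulr2n lerD// ?phib// Pb.
rewrite (_ : _ - _ = (phi (t * y) - Q) * (p.[y] * kappa y)); last by ring.
rewrite -(mulrA _ p.[y]) !exprMn; apply: ler_wpM2r.
  by rewrite mulr_ge0// sqr_ge0.
rewrite -exprMn -[leLHS]real_normK ?num_real// lerXn2r// nnegrE.
by rewrite mulr_ge0// expR_ge0.
Qed.

Lemma expR_mul (U : set (R -> R)) (t : R) kappa :
  linear_set U -> dominated_closed leb setT (fun=> 1) U -> gauss_decay kappa ->
  (forall p, U (fun y => p.[y] * kappa y)) ->
  forall p, U (fun y => p.[y] * (expR (t * y) * kappa y)).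
Proof.
move=> lU dU gk; apply: (@power_series_mul U (fun j => (j`!%:R)^-1)) => //.
  by move=> j; rewrite ger0_norm.
move=> y; rewrite (_ : (fun n => _) = series (exp_coeff y)).
  exact: is_cvg_series_exp_coeff.
by apply/funext => n; rewrite exp_coeffE.
Qed.

Let natr_bool_sign (b : bool) k (j : nat) :
  `|b%:R * (-1) ^+ k * (j`!%:R)^-1 : R| <= (j`!%:R)^-1.
Proof.
rewrite !normrM normr_sign mulr1 [`|_^-1|]ger0_norm//.
by case: b; rewrite ?normr1 ?mul1r// normr0 mul0r.
Qed.

Lemma cos_mul (U : set (R -> R)) (t : R) kappa :
  linear_set U -> dominated_closed leb setT (fun=> 1) U -> gauss_decay kappa ->
  (forall p, U (fun y => p.[y] * kappa y)) ->
  forall p, U (fun y => p.[y] * (cos (t * y) * kappa y)).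
Proof.
move=> lU dU gk.
apply: (@power_series_mul U (fun j => (~~ odd j)%:R * (-1) ^+ j./2 * (j`!%:R)^-1)) => //.
  move=> y; rewrite cos.unlock (_ : (fun n => _) = series (cos_coeff y)).
    exact: is_cvg_series_cos_coeff.
  by apply/funext => n; rewrite cos_coeffE.
by apply: continuous_measurable_fun; exact: continuous_cos.
Qed.

Lemma sin_mul (U : set (R -> R)) (t : R) kappa :
  linear_set U -> dominated_closed leb setT (fun=> 1) U -> gauss_decay kappa ->
  (forall p, U (fun y => p.[y] * kappa y)) ->
  forall p, U (fun y => p.[y] * (sin (t * y) * kappa y)).
Proof.
move=> lU dU gk.
apply: (@power_series_mul U (fun j => (odd j)%:R * (-1) ^+ j.-1./2 * (j`!%:R)^-1)) => //.
  move=> y; rewrite sin.unlock (_ : (fun n => _) = series (sin_coeff y)).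
    exact: is_cvg_series_sin_coeff.
  by apply/funext => n; rewrite sin_coeffE.
by apply: continuous_measurable_fun; exact: continuous_sin.
Qed.

End GaussianPowerSeries.

(** * Complex-valued square integrable functions *)

Section ComplexPlane.
Context {R : realType}.
Local Notation C := R[i].
Implicit Types (z u v : C) (t s : R).

Definition normsq z : R := complex.Re z ^+ 2 + complex.Im z ^+ 2.

Lemma normc_sqr z : ComplexField.Normc.normc z ^+ 2 = normsq z.
Proof. by case: z => a b; rewrite /ComplexField.Normc.normc sqr_sqrtr// addr_ge0 ?sqr_ge0. Qed.

Lemma normsq_ge0 z : 0 <= normsq z. Proof. by rewrite addr_ge0 ?sqr_ge0. Qed.

Lemma normsqM u v : normsq (u * v) = normsq u * normsq v.
Proof. by case: u v => [a b] [c d]; rewrite /normsq /=; ring. Qed.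

Lemma normsqD_le u v : normsq (u + v) <= 2 * normsq u + 2 * normsq v.
Proof.
case: u v => [a b] [c d]; rewrite /normsq /=.
have := sqr_ge0 (a - c); have := sqr_ge0 (b - d); rewrite !expr2; nra.
Qed.

Lemma normsq_real (t : R) : normsq t%:C = t ^+ 2.
Proof. by rewrite /normsq /= expr0n addr0. Qed.

Lemma ReM u v : complex.Re (u * v) = complex.Re u * complex.Re v - complex.Im u * complex.Im v.
Proof. by case: u v => [a b] [c d]. Qed.

Lemma ImM u v : complex.Im (u * v) = complex.Re u * complex.Im v + complex.Im u * complex.Re v.
Proof. by case: u v => [a b] [c d]. Qed.

Lemma ReD u v : complex.Re (u + v) = complex.Re u + complex.Re v.
Proof. by case: u v => [a b] [c d]. Qed.

Lemma ImD u v : complex.Im (u + v) = complex.Im u + complex.Im v.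
Proof. by case: u v => [a b] [c d]. Qed.

Definition cis t : C := cos t +i* sin t.

Lemma cisD t s : cis (t + s) = cis t * cis s.
Proof. by apply/eqP; rewrite eq_complex /= cosD sinD eqxx/= addrC. Qed.

Lemma conjcM u v : conjc (u * v) = conjc u * conjc v.
Proof. by case: u v => [a b] [c d]; apply/eqP; rewrite eq_complex /=; apply/andP; split;
  apply/eqP; ring. Qed.

Lemma cis0 : cis 0 = 1.
Proof. by rewrite /cis cos0 sin0. Qed.

Lemma cisN t : cis (- t) = (cis t)^*.
Proof. by rewrite /cis cosN sinN. Qed.

Lemma cisNK t : cis (- t) * cis t = 1.
Proof. by rewrite -cisD addNr cis0. Qed.

Lemma normsq_cis t : normsq (cis t) = 1.
Proof. exact: cos2Dsin2. Qed.

Lemma cis_2pi (n : int) : cis (2 * pi * n%:~R) = 1.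
Proof.
have pos (k : nat) : cis (2 * pi * k%:R) = 1.
  elim: k => [|k IH]; first by rewrite mulr0 cis0.
  rewrite (_ : 2 * pi * k.+1%:R = 2 * pi * k%:R + pi *+ 2); last by rewrite -natr1; ring.
  by rewrite cisD IH mul1r /cis cos2pi sin2pi.
case: (intP n) => [|k|k]; first by rewrite mulr0 cis0.
  exact: pos.
by rewrite mulrNz mulrN cisN pos conjc1.
Qed.

Lemma cexpE z : cexp z = (expR (complex.Re z))%:C * cis (complex.Im z).
Proof. by []. Qed.

Lemma cexpD u v : cexp (u + v) = cexp u * cexp v.
Proof. by rewrite !cexpE ReD ImD expRD cisD rmorphM /= mulrACA. Qed.

Lemma cvg_sqr_dist (u : nat -> R) (l k : R) :
  u n @[n --> \oo] --> l -> (l - u n) ^+ 2 * k @[n --> \oo] --> (0 : R).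
Proof.
move=> ul; rewrite [X in _ --> X](_ : 0 = (l - l) * (l - l) * k); last by rewrite subrr !mul0r.
apply: cvgM; last exact: cvg_cst.
under eq_fun do rewrite expr2.
by apply: cvgM; apply: cvgB => //; exact: cvg_cst.
Qed.

End ComplexPlane.

Section LinSpan.
Context (R : realType) (I : eqType) (T : Type).
Local Notation C := R[i].
Implicit Types (e : I -> T -> C) (F G : T -> C).

Definition lin_span e F := exists (s : seq I) (c : I -> C),
  forall x, F x = \sum_(k <- s) c k * e k x.

Lemma lin_span_gen e k : lin_span e (e k).
Proof. by exists [:: k], (fun=> 1) => x; rewrite big_seq1 mul1r. Qed.

(** Rewrites a sum over a list with repetitions as a sum over a duplicate-free list. A linear
combination is given by one coefficient for each index, so two combinations can be added only
once they are written over a common duplicate-free list. *)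
Lemma sum_seq_count (f : I -> C) (s u : seq I) : uniq u -> {subset s <= u} ->
  \sum_(k <- s) f k = \sum_(k <- u) f k *+ count_mem k s.
Proof.
move=> uu; elim: s => [|x s IH] su; first by rewrite big_nil big1.
rewrite big_cons IH => [|k ks]; last by apply: su; rewrite inE ks orbT.
rewrite (bigD1_seq x)/= ?su ?inE ?eqxx//= [RHS](bigD1_seq x)/= ?su ?inE ?eqxx//=.
rewrite addrA mulrS; congr (_ + _); apply: eq_bigr => k kx.
by rewrite eq_sym (negPf kx).
Qed.

Lemma lin_spanD e (a : C) F G : lin_span e F -> lin_span e G ->
  lin_span e (fun x => a * F x + G x).
Proof.
move=> [s [c FE]] [r [b GE]]; pose u := undup (s ++ r).
have uu : uniq u by exact: undup_uniq.
exists u, (fun k => a * c k *+ count_mem k s + b k *+ count_mem k r) => x.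
rewrite FE GE (sum_seq_count _ uu) => [|k ks]; last by rewrite mem_undup mem_cat ks.
rewrite (sum_seq_count (fun k => b k * _) uu) => [|k ks];
  last by rewrite mem_undup mem_cat ks orbT.
rewrite mulr_sumr -big_split /=; apply: eq_bigr => k _.
by rewrite mulrDl !mulrnAl !mulrnAr mulrA.
Qed.

End LinSpan.

Section ComplexL2.
Context d (T : measurableType d) (R : realType) (I : eqType).
Variables (mu : {measure set T -> \bar R}) (D : set T).
Hypothesis mD : measurable D.
Local Notation C := R[i].
Implicit Types (F G : T -> C) (e : I -> T -> C).

Definition cmeasurable_fun F := measurable_fun setT (fun x => complex.Re (F x)) /\
  measurable_fun setT (fun x => complex.Im (F x)).

Lemma cmeasurable_funD F G : cmeasurable_fun F -> cmeasurable_fun G -> cmeasurable_fun (fun x =>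
  F x + G x).
Proof.
move=> [F1 F2] [G1 G2]; split.
  by under eq_fun do rewrite ReD; exact: measurable_funD.
by under eq_fun do rewrite ImD; exact: measurable_funD.
Qed.

Lemma cmeasurable_funM F G : cmeasurable_fun F -> cmeasurable_fun G -> cmeasurable_fun (fun x =>
  F x * G x).
Proof.
move=> [F1 F2] [G1 G2]; split.
  under eq_fun do rewrite ReM.
  by apply: measurable_funB; exact: measurable_funM.
under eq_fun do rewrite ImM.
by apply: measurable_funD; exact: measurable_funM.
Qed.

Lemma cmeasurable_fun_cst (a : C) : cmeasurable_fun (fun=> a).
Proof. by split. Qed.

Lemma cmeasurable_fun_real (f : T -> R) : measurable_fun setT f -> cmeasurable_fun (fun x =>
  (f x)%:C).
Proof. by split. Qed.

Lemma cmeasurable_fun_cis (f : T -> R) : measurable_fun setT f -> cmeasurable_fun (fun x =>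
  cis (f x)).
Proof.
by move=> mf; split; apply: measurableT_comp => //; apply: continuous_measurable_fun;
  [exact: continuous_cos|exact: continuous_sin].
Qed.

Lemma cmeasurable_funB F G : cmeasurable_fun F -> cmeasurable_fun G -> cmeasurable_fun (fun x =>
  F x - G x).
Proof.
move=> mF mG; rewrite (_ : (fun x => _) = (fun x => F x + (-1) * G x)).
  by apply: cmeasurable_funD => //; apply: cmeasurable_funM => //; exact: cmeasurable_fun_cst.
by apply/funext => x; rewrite mulN1r.
Qed.

Lemma measurable_normsq F : cmeasurable_fun F -> measurable_fun setT (fun x => normsq (F x)).
Proof. by move=> [F1 F2]; apply: measurable_funD; exact: measurable_funX. Qed.

Lemma cmeasurable_fun_span e F : (forall k, cmeasurable_fun (e k)) -> lin_span e F ->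
  cmeasurable_fun F.
Proof.
move=> me [s [c FE]]; rewrite (_ : F = fun x => \sum_(k <- s) c k * e k x); last exact/funext.
elim: s {FE} => [|k s IH].
  under eq_fun do rewrite big_nil; exact: cmeasurable_fun_cst.
under eq_fun do rewrite big_cons.
by apply: cmeasurable_funD => //; apply: cmeasurable_funM => //; exact: cmeasurable_fun_cst.
Qed.

Definition L2sq F : \bar R := (\int[mu]_(x in D) (normsq (F x))%:E)%E.

Lemma L2sq_ge0 F : (0 <= L2sq F)%E.
Proof. by apply: integral_ge0 => x _; rewrite lee_fin normsq_ge0. Qed.

Let mnormsq F : cmeasurable_fun F -> measurable_fun D (fun x => (normsq (F x))%:E).
Proof. by move=> mF; apply/measurable_EFinP; apply: measurable_funTS;
  exact: measurable_normsq. Qed.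

Lemma L2sqD_le F G : cmeasurable_fun F -> cmeasurable_fun G ->
  (L2sq (fun x => F x + G x)%R <= 2%:E * L2sq F + 2%:E * L2sq G)%E.
Proof.
move=> mF mG; rewrite /L2sq -!ge0_integralZl//; try exact: mnormsq;
  try by move=> x _; rewrite lee_fin normsq_ge0.
have m2 H : cmeasurable_fun H -> measurable_fun D (fun x => 2%:E * (normsq (H x))%:E)%E.
  by move=> mH; apply: measurable_funeM; exact: mnormsq.
have ge0 H x : D x -> (0 <= 2%:E * (normsq (H x))%:E)%E.
  by move=> _; rewrite -EFinM lee_fin mulr_ge0// normsq_ge0.
rewrite -ge0_integralD//; [|exact: ge0|exact: m2|exact: ge0|exact: m2].
apply: ge0_le_integral => //.
- by move=> x _; rewrite lee_fin normsq_ge0.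
- by apply: mnormsq; exact: cmeasurable_funD.
- by apply: emeasurable_funD; exact: m2.
- by move=> x _; rewrite -!EFinM -EFinD lee_fin; exact: normsqD_le.
Qed.

Lemma L2sqZ (a : C) F : cmeasurable_fun F -> L2sq (fun x => a * F x)%R =
  ((normsq a)%:E * L2sq F)%E.
Proof.
move=> mF; rewrite /L2sq -ge0_integralZl ?lee_fin ?normsq_ge0//; last 2 first.
- exact: mnormsq.
- by move=> x _; rewrite lee_fin normsq_ge0.
by apply: eq_integral => x _; rewrite normsqM EFinM.
Qed.

Variable e : I -> T -> C.
Hypothesis me : forall k, cmeasurable_fun (e k).

Definition closed_span F := cmeasurable_fun F /\ forall eps : R, 0 < eps ->
  exists2 G, lin_span e G & (L2sq (fun x => F x - G x)%R < eps%:E)%E.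

Lemma closed_span_sub F : lin_span e F -> closed_span F.
Proof.
move=> sF; split; first exact: cmeasurable_fun_span sF.
move=> eps e0; exists F => //; rewrite /L2sq integral0_eq ?lte_fin//.
by move=> x _; rewrite subrr normsq_real expr0n.
Qed.

Lemma closed_spanD (a : C) F G : closed_span F -> closed_span G ->
  closed_span (fun x => a * F x + G x).
Proof.
move=> [mF aF] [mG aG]; split.
  by apply: cmeasurable_funD => //; apply: cmeasurable_funM => //; exact: cmeasurable_fun_cst.
(* adding 1 avoids a division by 0 when a = 0 *)
move=> eps e0; pose k : R := normsq a + 1.
have k0 : 0 < k by rewrite /k; have := normsq_ge0 a; lra.
have d0 : 0 < eps / (4 * k) by rewrite divr_gt0// mulr_gt0.
have d1 : 0 < eps / 4 by lra.
have [F' sF' hF] := aF _ d0; have [G' sG' hG] := aG _ d1.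
exists (fun x => a * F' x + G' x); first exact: lin_spanD.
have mF' := cmeasurable_fun_span me sF'; have mG' := cmeasurable_fun_span me sG'.
rewrite (_ : (fun x => _) = (fun x => a * (F x - F' x) + (G x - G' x))); last first.
  by apply/funext => x; ring.
have mFF := cmeasurable_funB mF mF'; have mGG := cmeasurable_funB mG mG'.
apply: (le_lt_trans (L2sqD_le _ mGG)).
  by apply: cmeasurable_funM => //; exact: cmeasurable_fun_cst.
rewrite L2sqZ//; move: hF hG (L2sq_ge0 (fun x => F x - F' x)) (L2sq_ge0 (fun x => G x - G' x)).
case: (L2sq _) => // r; case: (L2sq _) => // r'; rewrite !lte_fin !lee_fin => h1 h2 h3 h4.
have h5 : k * r < eps / 4.
  move: h1; rewrite -(ltr_pM2l k0) (_ : k * (eps / (4 * k)) = eps / 4)//.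
  by field; rewrite gt_eqF.
by move: h5; rewrite /k mulrDl mul1r => h5; lra.
Qed.

Lemma closed_span_closed F : cmeasurable_fun F ->
  (forall eps : R, 0 < eps -> exists2 G, closed_span G & (L2sq (fun x =>
    F x - G x)%R < eps%:E)%E) ->
  closed_span F.
Proof.
move=> mF aF; split => // eps e0; have e4 : 0 < eps / 4 by lra.
have [G [mG aG] hG] := aF _ e4; have [H sH hH] := aG _ e4.
exists H => //; have mH := cmeasurable_fun_span me sH.
rewrite (_ : (fun x => _) = (fun x => (F x - G x) + (G x - H x))); last first.
  by apply/funext => x; ring.
apply: (le_lt_trans (L2sqD_le (cmeasurable_funB mF mG) (cmeasurable_funB mG mH))).
move: hG hH (L2sq_ge0 (fun x => F x - G x)) (L2sq_ge0 (fun x => G x - H x)).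
case: (L2sq _) => // r; case: (L2sq _) => // r'; rewrite !lte_fin => h1 h2 _ _.
lra.
Qed.

(** Dominated convergence applied to |F - F_n|^2. *)
Lemma closed_span_dominated (F_ : nat -> T -> C) F (h : T -> R) :
  (forall n, closed_span (F_ n)) -> cmeasurable_fun F ->
  (forall x, D x -> normsq (F x - F_ n x) @[n --> \oo] --> (0 : R)) ->
  mu.-integrable D (EFin \o h) ->
  (forall n x, D x -> normsq (F x - F_ n x) <= h x) -> closed_span F.
Proof.
move=> aF mF cF ih hF; apply: closed_span_closed => // eps e0.
have mFn n : cmeasurable_fun (fun x => F x - F_ n x) by apply: cmeasurable_funB => //; have [] :=
  aF n.
have [] := @dominated_convergence _ _ _ mu D mD
  (fun n x => (normsq (F x - F_ n x))%:E) (fun=> 0%E) (EFin \o h).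
- by move=> n; exact: mnormsq.
- exact: measurable_cst.
- by apply: aeW => x Dx; apply: cvg_EFin; [exact: nearW|exact: cF].
- by [].
- apply: aeW => x n Dx; by rewrite gee0_abs ?lee_fin ?normsq_ge0// hF.
move=> _ _; rewrite integral0 => /fine_cvgP[fin c0].
have /cvgrPdist_lt/(_ _ e0) c1 := c0.
near \oo => n.
have fn : L2sq (fun x => F x - F_ n x) \is a fin_num by near: n; exact: fin.
have cn : `|0 - fine (L2sq (fun x => F x - F_ n x))| < eps by near: n; exact: c1.
exists (F_ n) => //; rewrite -(fineK fn) lte_fin.
by move: cn; rewrite sub0r normrN ger0_norm// fine_ge0// L2sq_ge0.
Unshelve. all: by end_near. Qed.

End ComplexL2.

(** * Integrals of tensor products *)

Section ProductIntegrals.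
Context d1 d2 (T1 : measurableType d1) (T2 : measurableType d2) (R : realType).
Variables (m1 : {sigma_finite_measure set T1 -> \bar R}).
Variables (m2 : {sigma_finite_measure set T2 -> \bar R}).
Implicit Types (f : T1 -> R) (g : T2 -> R).

Lemma integral_tensorT f g :
  m1.-integrable setT (EFin \o f) -> m2.-integrable setT (EFin \o g) ->
  (m1 \x m2)%E.-integrable setT (fun p => (f p.1 * g p.2)%:E) /\
  (\int[(m1 \x m2)%E]_p (f p.1 * g p.2) = (\int[m1]_x f x) * (\int[m2]_y g y))%R.
Proof.
move=> fi gi.
have mf : measurable_fun setT f by have /integrableP[/measurable_EFinP] := fi.
have mg : measurable_fun setT g by have /integrableP[/measurable_EFinP] := gi.
have mfg : measurable_fun setT (fun p : T1 * T2 => (f p.1 * g p.2)%:E).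
  apply/measurable_EFinP; apply: measurable_funM.
    exact: (measurableT_comp mf measurable_fst).
  exact: (measurableT_comp mg measurable_snd).
have fgi : (m1 \x m2)%E.-integrable setT (fun p => (f p.1 * g p.2)%:E).
  apply/integrable12ltyP => //.
  have E : (\int[m1]_x \int[m2]_y `|(f x * g y)%:E| =
            (\int[m1]_x `|(EFin \o f) x|) * (\int[m2]_y `|(EFin \o g) y|))%E.
    rewrite -ge0_integralZr//; last 2 first.
    - by apply: measurableT_comp => //; exact/measurable_EFinP.
    - exact: integral_ge0.
    apply: eq_integral => x _; rewrite -ge0_integralZl//.
      by apply: eq_integral => y _; rewrite EFinM abseM.
    by apply: measurableT_comp => //; exact/measurable_EFinP.
  rewrite /= E; apply: lte_mul_pinfty; first exact: integral_ge0.
    have /integrableP[_] := fi; rewrite ge0_fin_numE//; exact: integral_ge0.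
  by have /integrableP[] := gi.
split => //; rewrite /Rintegral -integral12_prod_meas1//=.
rewrite -fineM; last 2 first.
- exact: integrable_fin_num.
- exact: integrable_fin_num.
have gfin : (\int[m2]_y (g y)%:E)%E = (\int[m2]_y g y)%:E%R.
  by rewrite /Rintegral fineK//; exact: integrable_fin_num.
congr fine; rewrite gfin.
rewrite (_ : \int[m1]_x (f x)%:E = \int[m1]_x (EFin \o f) x)%E// -integralZr//.
apply: eq_integral => x _; rewrite -gfin /fubini_F /=.
rewrite (_ : \int[m2]_y (g y)%:E = \int[m2]_y (EFin \o g) y)%E// -integralZl//.
Qed.

Lemma integral_tensor f g (A : set T1) (B : set T2) :
  measurable A -> measurable B ->
  m1.-integrable A (EFin \o f) -> m2.-integrable B (EFin \o g) ->
  (m1 \x m2)%E.-integrable (A `*` B) (fun p => (f p.1 * g p.2)%:E) /\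
  (\int[(m1 \x m2)%E]_(p in A `*` B) (f p.1 * g p.2) =
   (\int[m1]_(x in A) f x) * (\int[m2]_(y in B) g y))%R.
Proof.
move=> mA mB fi gi; have mAB : measurable (A `*` B) by exact: measurableX.
have patchE : (fun p : T1 * T2 => f p.1 * g p.2) \_ (A `*` B) =
    (fun p => (f \_ A) p.1 * (g \_ B) p.2).
  apply/funext => p; rewrite !patchE in_setX.
  by case: (p.1 \in A); case: (p.2 \in B); rewrite ?mul0r ?mulr0.
have [] := @integral_tensorT (f \_ A) (g \_ B).
- by rewrite -restrict_EFin; exact: (integrable_mkcond _ mA).1.
- by rewrite -restrict_EFin; exact: (integrable_mkcond _ mB).1.
move=> i E; split; last by rewrite Rintegral_mkcond patchE E -!Rintegral_mkcond.
apply: (integrable_mkcond _ mAB).2.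
rewrite (_ : _ \_ _ = EFin \o (fun p => (f \_ A) p.1 * (g \_ B) p.2))//.
by rewrite -patchE -restrict_EFin.
Qed.

End ProductIntegrals.

(** * Trigonometric functions on the unit interval *)

Section TrigonometricFunctions.
Context {R : realType}.
Local Notation leb := (@lebesgue_measure R).

Lemma continuous_cosM (b : R) : continuous (fun x : R => cos (b * x)).
Proof.
move=> x; apply: (@continuous_comp _ _ _ (fun x => b * x)); last exact: continuous_cos.
by apply: continuousM; [exact: cvg_cst|exact: cvg_id].
Qed.

Lemma continuous_sinM (b : R) : continuous (fun x : R => sin (b * x)).
Proof.
move=> x; apply: (@continuous_comp _ _ _ (fun x => b * x)); last exact: continuous_sin.
by apply: continuousM; [exact: cvg_cst|exact: cvg_id].
Qed.

Lemma integral_unit_trig (k : int) :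
  (\int[leb]_(x in `[0%R, 1%R]) cos (2 * pi * k%:~R * x) = (k == 0)%:R)%R /\
  (\int[leb]_(x in `[0%R, 1%R]) sin (2 * pi * k%:~R * x) = 0)%R.
Proof.
set b := 2 * pi * k%:~R.
have [k0|k0] := eqVneq k 0.
  have b0 : b = 0 by rewrite /b k0 mulr0.
  split.
    under eq_Rintegral do rewrite b0 mul0r cos0.
    by rewrite Rintegral_cst//= lebesgue_measure_itv/= lte_fin ltr01 sube0 mul1r.
  under eq_Rintegral do rewrite b0 mul0r sin0.
  by rewrite Rintegral_cst// mul0r.
have b0 : b != 0 by rewrite mulf_neq0// ?intr_eq0// mulf_neq0// gt_eqF// pi_gt0.
have [c2 s2] : cos b = 1 /\ sin b = 0.
  by have := @cis_2pi R k; rewrite /cis -/b => -[-> ->].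
have FTC (f F : R -> R) : continuous f -> (forall x : R, is_derive x 1 F (f x)) ->
    (\int[leb]_(x in `[0%R, 1%R]) f x = F 1 - F 0)%R.
  move=> cf dF; have cF : continuous F.
    move=> x; apply/differentiable_continuous/derivable1_diffP.
    by have [] := dF x.
  rewrite /Rintegral (@continuous_FTC2 _ f F)//.
  - exact: continuous_subspaceT.
  - split; first by move=> x _; have [] := dF x.
    + by apply: cvg_at_right_filter; exact: cF.
    + by apply: cvg_at_left_filter; exact: cF.
  - by move=> x _; rewrite derive1E; have [_ ->] := dF x.
have dl (x : R) : is_derive x 1 (fun x => b * x) b.
  by apply: (@trigger_derive _ (b \*: id)); rewrite /GRing.scale /= mulr1.
have dsin (x : R) : is_derive x 1 (fun x => b^-1 * sin (b * x)) (cos (b * x)).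
  apply: (@trigger_derive _ (b^-1 \*: (sin \o (fun x => b * x)))).
  by rewrite /GRing.scale /=; field.
have dcos (x : R) : is_derive x 1 (fun x => - b^-1 * cos (b * x)) (sin (b * x)).
  apply: (@trigger_derive _ ((- b^-1) \*: (cos \o (fun x => b * x)))).
  by rewrite /GRing.scale /=; field.
split.
  by rewrite (FTC _ _ (@continuous_cosM b) dsin) mulr1 mulr0 s2 sin0 subrr.
by rewrite (FTC _ _ (@continuous_sinM b) dcos) mulr1 mulr0 c2 cos0 subrr.
Qed.

(** The derivative at 0 of t |-> sin (t y), along the sequence 1 / (n + 1). *)
Lemma cvg_scaled_sin (y : R) : n.+1%:R * sin (n.+1%:R^-1 * y) @[n --> \oo] --> y.
Proof.
have df : is_derive (0 : R) 1 (sin \o (fun t => t * y)) y.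
  have dl : is_derive (0 : R) 1 (fun t : R => t * y) y.
    rewrite (_ : (fun t => t * y) = y \*: id); last by apply/funext => t; rewrite mulrC.
    by apply: (@trigger_derive _ (y \*: id)); rewrite /GRing.scale /= mulr1.
  by apply: (@trigger_derive _ (sin \o (fun t => t * y))); rewrite /= mul0r cos0 ?mulr1 ?mul1r.
have [dv dE] := df; set f := sin \o _ in dv dE.
have fcvg z : 'D_1 f (0 : R) = z ->
    (h^-1 *: ((f \o shift 0) (h *: 1) - f 0)) @[h --> (0 : R)^'] --> z.
  by move=> <-; exact: dv.
have /cvg_dnbhs_at_right/cvg_at_rightP/(_ (fun n => n.+1%:R^-1)) := fcvg _ dE.
move=> H; have := H _; rewrite /= => {}H.
rewrite (_ : (fun n => _) = (fun n : nat => n.+1%:R^-1^-1 *: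
  (sin ((n.+1%:R^-1 *: 1 + 0) * y) - sin (0 * y)))).
  by apply: H; split; [move=> n; rewrite invr_gt0|exact: cvg_harmonic].
by apply/funext => n; rewrite invrK /GRing.scale /= mulr1 addr0 mul0r sin0 subr0.
Qed.

End TrigonometricFunctions.

(** * The weighted functions and their orthonormality *)

Section WeightedFamily.
Context {R : realType}.
Variables (nu alpha : R).
Hypothesis nu0 : 0 < nu.
Local Notation C := R[i].
Local Notation plane := (measurableTypeR R * measurableTypeR R)%type.
Local Notation leb := (@lebesgue_measure R).
Local Notation leb2 := (@lebesgue_measure R \x @lebesgue_measure R)%E.

Definition hermite_scale : R := Num.sqrt (2 * nu).
Definition hermite_shift (n : int) : R := Num.sqrt (2 / nu) * pi * (n%:~R + alpha).
Local Notation a := hermite_scale.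
Local Notation c := hermite_shift.

(** The square root of the Gaussian against which the n-th family of Hermite polynomials is
orthogonal. *)
Definition root_gauss (n : int) (y : R) : R := expR (- (a * y + c n) ^+ 2 / 2).

Definition hermite_norm (m : nat) : R :=
  ((2 ^ m * m`!)%N%:R `^ (- (1 / 2))) * ((2 * nu / pi) `^ (1 / 4)).

Definition hermite_fun (m : nat) (n : int) (y : R) : R :=
  hermite_norm m * (hermite_poly m).[a * y + c n] * root_gauss n y.

Definition weighted_psi (k : nat * int) (p : plane) : C :=
  cis (2 * pi * k.2%:~R * p.1) * (hermite_fun k.1 k.2 p.2)%:C.

(** The imaginary part of nu z^2 / 2 + 2 i pi alpha z, which is the part of the exponent of
psi that is common to all indices. *)
Definition phase (p : plane) : R := nu * p.1 * p.2 + 2 * pi * alpha * p.1.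

Definition root_weight (p : plane) : R := expR (- nu / 2 * (p.1 ^+ 2 + p.2 ^+ 2)).

Lemma hermite_scale_gt0 : 0 < a.
Proof. by rewrite sqrtr_gt0 mulr_gt0. Qed.

Lemma hermite_scale2 : a ^+ 2 = 2 * nu.
Proof. by rewrite sqr_sqrtr// mulr_ge0// ltW. Qed.

Lemma hermite_scale_shift n : a * c n = 2 * (pi * (n%:~R + alpha)).
Proof.
have s4 : Num.sqrt (2 * nu) * Num.sqrt (2 / nu) = 2.
  rewrite -sqrtrM; last by rewrite mulr_ge0// ltW.
  rewrite (_ : 2 * nu * (2 / nu) = 2 ^+ 2); last by field; rewrite gt_eqF.
  by rewrite sqrtr_sqr ger0_norm.
by rewrite /a /c -[in RHS]s4; ring.
Qed.

Lemma hermite_shift2 n : c n ^+ 2 = 2 / nu * pi ^+ 2 * (n%:~R + alpha) ^+ 2.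
Proof. by rewrite /c !exprMn sqr_sqrtr// divr_ge0// ltW. Qed.

(** Completing the square: the real part of the exponent of psi, the Gaussian constant in its
coefficient and half of the exponent of the weight add up to - (a y + c_n)^2 / 2. *)
Lemma psi_weightedE k p :
  psi alpha nu k (ofR2 p) * (root_weight p)%:C = cis (phase p) * weighted_psi k p.
Proof.
case: k => m n; case: p => x y.
rewrite /psi /psi_const /weighted_psi /root_weight /phase /= hermiteE cexpE.
set w := (nu / 2)%:C * _ + _.
have -> : complex.Re w = nu / 2 * (x ^+ 2 - y ^+ 2) - 2 * (pi * (alpha + n%:~R)) * y.
  by rewrite /w /ofR2 expr2; simpc => /=; ring.
have -> : complex.Im w = (nu * x * y + 2 * pi * alpha * x) + 2 * pi * n%:~R * x.
  by rewrite /w /ofR2 expr2; simpc => /=; field.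
rewrite cisD /hermite_fun /root_gauss /hermite_norm -/(hermite_scale).
set k1 := _ `^ _; set k2 := _ `^ _; set H := _.[_].
have -> : expR (- (a * y + c n) ^+ 2 / 2) =
   expR (- (pi ^+ 2 / nu) * (alpha + n%:~R) ^+ 2) *
   expR (nu / 2 * (x ^+ 2 - y ^+ 2) - 2 * (pi * (alpha + n%:~R)) * y) *
   expR (- nu / 2 * (x ^+ 2 + y ^+ 2)).
  rewrite -!expRD; congr expR.
  rewrite (_ : (a * y + c n) ^+ 2 = a ^+ 2 * y ^+ 2 + 2 * (a * c n) * y + c n ^+ 2); last by ring.
  rewrite hermite_scale2 hermite_scale_shift hermite_shift2; field; rewrite gt_eqF//.
rewrite !rmorphM /=; ring.
Qed.

Lemma hermite_norm2 m : hermite_norm m ^+ 2 * (2 ^ m * m`!)%:R * (Num.sqrt pi / a) = 1.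
Proof.
set f : R := (2 ^ m * m`!)%:R.
have f0 : 0 < f by rewrite ltr0n muln_gt0 expn_gt0 fact_gt0.
have b0 : 0 < 2 * nu / pi by rewrite divr_gt0 ?mulr_gt0 ?pi_gt0.
rewrite /hermite_norm -/f exprMn -!powR_mulrn ?powR_ge0// -!powRrM.
rewrite (_ : - (1 / 2) * 2 = -1); last by field.
rewrite (_ : 1 / 4 * 2 = 2^-1); last by field.
rewrite powR_inv1 ?ltW// powR12_sqrt ?ltW//.
have -> : Num.sqrt (2 * nu / pi) = a / Num.sqrt pi.
  by rewrite sqrtrM ?mulr_ge0 ?ltW// sqrtrV// pi_ge0.
field; rewrite !gt_eqF ?hermite_scale_gt0//= sqrtr_gt0 pi_gt0//.
Qed.

Lemma root_gauss_sqr n y : root_gauss n y * root_gauss n y = gauss a (c n) y.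
Proof. by rewrite /root_gauss /gauss -expRD; congr expR; field. Qed.

Lemma measurable_root_gauss n : measurable_fun setT (root_gauss n).
Proof.
apply: measurableT_comp => //; apply: measurable_funM => //.
rewrite (_ : (fun y => _) = horner (- (a%:P * 'X + (c n)%:P) ^+ 2)).
  exact: measurable_horner.
by apply/funext => y; rewrite !hornerE.
Qed.

Lemma measurable_hermite_fun m n : measurable_fun setT (hermite_fun m n).
Proof.
apply: measurable_funM; last exact: measurable_root_gauss.
apply: measurable_funM => //.
rewrite (_ : (fun y => _) = horner (hermite_poly m \Po (a%:P * 'X + (c n)%:P))).
  exact: measurable_horner.
by apply/funext => y; rewrite horner_comp !hornerE.
Qed.

Lemma hermite_fun_mul j k n y : hermite_fun j n y * hermite_fun k n y =
  hermite_norm j * hermite_norm k * ((hermite_poly j * hermite_poly k).[a * y + c n] * gauss a (c n) y).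
Proof. by rewrite hornerM -root_gauss_sqr /hermite_fun; ring. Qed.

Lemma hermite_fun_orthonormal j k n :
  leb.-integrable setT (EFin \o (fun y => hermite_fun j n y * hermite_fun k n y)) /\
  (\int[leb]_y (hermite_fun j n y * hermite_fun k n y) = (j == k)%:R)%R.
Proof.
have a0 := hermite_scale_gt0.
have ig := integrable_gauss_mean (c n) (hermite_poly j * hermite_poly k) a0.
split.
  have ik := integrableZl measurableT (hermite_norm j * hermite_norm k) ig.
  apply: eq_integrable ik => // y _.
  by rewrite /= hermite_fun_mul EFinM.
under eq_Rintegral do rewrite hermite_fun_mul.
rewrite RintegralZl// -/(gauss_mean _ _ _) gauss_mean_orthogonal//.
have [->|jk] := eqVneq j k; last by rewrite !mul0r mulr0.
by have := hermite_norm2 k; rewrite expr2 mul1r !mulrA.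
Qed.

(** Both functions are square integrable, and |u v| <= u^2 + v^2; the two shifts may differ. *)
Lemma hermite_fun_mul_integrable j k n n' :
  leb.-integrable setT (EFin \o (fun y => hermite_fun j n y * hermite_fun k n' y)).
Proof.
have [i1 _] := hermite_fun_orthonormal j j n.
have [i2 _] := hermite_fun_orthonormal k k n'.
have i12 := integrableD measurableT i1 i2.
apply: le_integrable i12 => //.
  by apply/measurable_EFinP; apply: measurable_funM; exact: measurable_hermite_fun.
move=> y _ /=; rewrite lee_fin.
set u := hermite_fun j n y; set v := hermite_fun k n' y.
have h1 := sqr_ge0 (u - v); have h2 := sqr_ge0 (u + v).
rewrite [leRHS]ger0_norm ?addr_ge0 -?expr2 ?sqr_ge0// ler_norml.
by move: h1 h2; rewrite !expr2 => h1 h2; apply/andP; split; nra.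
Qed.

(** An isometry from the weighted space to L2 of the strip, which removes the phase common to
all the psi. *)
Definition weighted (f : C -> C) (p : plane) : C :=
  cis (- phase p) * (f (ofR2 p) * (root_weight p)%:C).

Lemma weighted_psiE k : weighted (psi alpha nu k) = weighted_psi k.
Proof. by apply/funext => p; rewrite /weighted psi_weightedE mulrA cisNK mul1r. Qed.

Lemma gauss_weightE p : gauss_weight nu (ofR2 p) = root_weight p * root_weight p.
Proof.
by rewrite /gauss_weight /root_weight -expRD normc_sqr /normsq /=; congr expR; field.
Qed.

Lemma normsq_weighted f p :
  normsq (weighted f p) = ComplexField.Normc.normc (f (ofR2 p)) ^+ 2 * gauss_weight nu (ofR2 p).
Proof.
by rewrite /weighted normsqM normsq_cis mul1r normsqM normsq_real gauss_weightE normc_sqr expr2.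
Qed.

Lemma sqnorm_weighted f : sqnorm nu f = L2sq leb2 (@strip R) (weighted f).
Proof. by apply: eq_integral => p _; rewrite normsq_weighted. Qed.

Lemma weighted_mulC f g p :
  f (ofR2 p) * (g (ofR2 p))^* * (gauss_weight nu (ofR2 p))%:C =
  weighted f p * conjc (weighted g p).
Proof.
rewrite [((g (ofR2 p))^*)%R]/(conjc (g (ofR2 p))) /weighted gauss_weightE rmorphM !conjcM -cisN opprK conjc_real.
transitivity (cis (- phase p) * cis (phase p) *
  (f (ofR2 p) * conjc (g (ofR2 p)) * ((root_weight p)%:C * (root_weight p)%:C))); last by ring.
by rewrite cisNK mul1r.
Qed.

Lemma measurable_phase : measurable_fun setT phase.
Proof.
apply: measurable_funD; apply: measurable_funM => //.
by apply: measurable_funM.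
Qed.

Lemma measurable_expR_sqr (b : R) :
  measurable_fun setT (fun p : plane => expR (b * (p.1 ^+ 2 + p.2 ^+ 2))).
Proof.
apply: measurableT_comp => //; apply: measurable_funM => //.
by apply: measurable_funD; apply: measurable_funX.
Qed.

Lemma cmeasurable_fun_weighted f : cmeasurable f -> cmeasurable_fun (weighted f).
Proof.
move=> mf; apply: cmeasurable_funM.
  by apply: cmeasurable_fun_cis; apply: measurableT_comp => //; exact: measurable_phase.
by apply: cmeasurable_funM => //; apply: cmeasurable_fun_real; exact: measurable_expR_sqr.
Qed.

Lemma cmeasurable_fun_weighted_psi k : cmeasurable_fun (weighted_psi k).
Proof.
apply: cmeasurable_funM.
  by apply: cmeasurable_fun_cis; apply: measurable_funM.
apply: cmeasurable_fun_real; apply: (measurableT_comp (measurable_hermite_fun k.1 k.2)).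
exact: measurable_snd.
Qed.

Lemma cmeasurable_psi k : cmeasurable (psi alpha nu k).
Proof.
have [] : cmeasurable_fun (fun p : plane => cis (phase p) * weighted_psi k p *
    (expR (nu / 2 * (p.1 ^+ 2 + p.2 ^+ 2)))%:C).
  apply: cmeasurable_funM; last by apply: cmeasurable_fun_real; exact: measurable_expR_sqr.
  apply: cmeasurable_funM; last exact: cmeasurable_fun_weighted_psi.
  by apply: cmeasurable_fun_cis; exact: measurable_phase.
have E p : cis (phase p) * weighted_psi k p * (expR (nu / 2 * (p.1 ^+ 2 + p.2 ^+ 2)))%:C
   = psi alpha nu k (ofR2 p).
  rewrite -psi_weightedE -mulrA -rmorphM /= /root_weight -expRD.
  by rewrite (_ : _ + _ = 0) ?expR0 ?mulr1//; ring.
by under eq_fun do rewrite E; move=> m1; under eq_fun do rewrite E.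
Qed.

Lemma integrable_one_unit_itv (b0 b1 : bool) :
  leb.-integrable [set` Interval (BSide b0 0%R) (BSide b1 1%R)] (EFin \o (fun=> 1 : R)).
Proof.
apply: measurable_bounded_integrable => //.
  by rewrite /= lebesgue_measure_itv/= lte_fin ltr01 sube0 ltry.
by exists 1; split => // r r1 x _ /=; rewrite normr1 ltW.
Qed.

Lemma L2sq_weighted_psi k : (L2sq leb2 (@strip R) (weighted_psi k) < +oo)%E.
Proof.
have [i1 _] := @integral_tensor _ _ _ _ _ leb leb (fun=> 1) _ `[0%R, 1%R]
  setT (measurable_itv _) measurableT (integrable_one_unit_itv true false)
  (hermite_fun_mul_integrable k.1 k.1 k.2 k.2).
have /integrableP[_] := i1; apply: le_lt_trans; apply: ge0_le_integral => //.
- exact: measurableX.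
- by move=> p _; rewrite lee_fin normsq_ge0.
- apply/measurable_EFinP; apply: measurable_funTS; apply: measurable_normsq.
  exact: cmeasurable_fun_weighted_psi.
- by apply: measurableT_comp => //; have /integrableP[] := i1.
- by move=> p _; rewrite /weighted_psi normsqM normsq_cis mul1r normsq_real mul1r -expr2 gee0_abs// lee_fin sqr_ge0.
Qed.

(** Replacing z by z + m leaves the imaginary part alone and adds to the exponent of psi the
exponents of the two factors of automorphy and 2 i pi n m, whose exponential is 1. *)
Lemma quasi_periodic_psi k : quasi_periodic alpha nu (psi alpha nu k).
Proof.
apply: aeW => p m /=; set z := ofR2 p; case: k => l n.
rewrite /psi.
have -> : complex.Im (z + m%:~R) = complex.Im z.
  by rewrite ImD (_ : complex.Im (m%:~R : C) = 0) ?addr0// -(rmorph_int (real_complex R)).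
set H := (hermite _ _)%:C; set K := (psi_const _ _ _ _)%:C.
(* the factor by which the exponential of frequency n changes *)
have e1 : cexp (2 * 'i%C * (pi * n%:~R)%:C * m%:~R) = 1 :> C.
  rewrite cexpE.
  have -> : 2 * 'i%C * (pi * n%:~R)%:C * m%:~R = 0 +i* (2 * pi * (n * m)%:~R) :> C.
    rewrite -(rmorph_int (real_complex R)) -(rmorph_nat (real_complex R)).
    by simpc; rewrite intrM; congr (_ +i* _); ring.
  by rewrite /= expR0 mul1r cis_2pi.
rewrite mulrA [in RHS]mulrA; congr (_ * H).
rewrite [RHS]mulrAC [RHS]mulrC; congr (K * _).
rewrite -!cexpD -[RHS]mulr1 -[X in _ = _ * X]e1 -cexpD; congr cexp.
rewrite (_ : (nu / 2)%:C = nu%:C / 2); last by rewrite rmorphM /= fmorphV /= rmorph_nat.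
have -> : (pi * (alpha + n%:~R))%:C = (pi * alpha)%:C + (pi * n%:~R)%:C :> C.
  by rewrite mulrDr rmorphD.
by field.
Qed.

Lemma psi_L2_auto k : L2_auto alpha nu (psi alpha nu k).
Proof.
split; [exact: cmeasurable_psi|exact: quasi_periodic_psi|].
by rewrite sqnorm_weighted weighted_psiE L2sq_weighted_psi.
Qed.

Lemma continuous_integrable_unit (f : R -> R) : continuous f ->
  leb.-integrable `[0%R, 1%R] (EFin \o f).
Proof.
move=> cf; apply: continuous_compact_integrable; first exact: segment_compact.
exact: continuous_subspaceT.
Qed.

Lemma inner_weighted f g : inner nu f g =
  Rintegral leb2 (@strip R) (fun p => complex.Re (weighted f p * conjc (weighted g p))) +i*
  Rintegral leb2 (@strip R) (fun p => complex.Im (weighted f p * conjc (weighted g p))).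
Proof.
by rewrite /inner; cbv zeta; congr (_ +i* _); apply: eq_Rintegral => p _; rewrite weighted_mulC.
Qed.

Lemma psi_orthonormal j k : inner nu (psi alpha nu j) (psi alpha nu k) = (j == k)%:R.
Proof.
case: j k => [j n] [k n'].
rewrite inner_weighted !weighted_psiE.
set b : R := 2 * pi * (n - n')%:~R.
have hE p : weighted_psi (j, n) p * conjc (weighted_psi (k, n') p) =
    cis (b * p.1) * (hermite_fun j n p.2 * hermite_fun k n' p.2)%:C.
  rewrite /weighted_psi conjcM conjc_real -cisN.
  rewrite (_ : b * p.1 = 2 * pi * n%:~R * p.1 + - (2 * pi * n'%:~R * p.1)).
    rewrite cisD [in RHS]rmorphM [LHS]mulrACA; congr (_ * _).
  by rewrite /b intrB; ring.
have ReE p : complex.Re (weighted_psi (j, n) p * conjc (weighted_psi (k, n') p)) =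
    cos (b * p.1) * (hermite_fun j n p.2 * hermite_fun k n' p.2).
  by rewrite hE ReM /= mulr0 subr0.
have ImE p : complex.Im (weighted_psi (j, n) p * conjc (weighted_psi (k, n') p)) =
    sin (b * p.1) * (hermite_fun j n p.2 * hermite_fun k n' p.2).
  by rewrite hE ImM /= mulr0 add0r.
under eq_Rintegral do rewrite ReE.
under [X in _ +i* X]eq_Rintegral do rewrite ImE.
have ih := hermite_fun_mul_integrable j k n n'.
have [_ ->] := @integral_tensor _ _ _ _ _ leb leb (fun x => cos (b * x)) _ `[0%R, 1%R]
  setT (measurable_itv _) measurableT (continuous_integrable_unit (@continuous_cosM R b)) ih.
have [_ ->] := @integral_tensor _ _ _ _ _ leb leb (fun x => sin (b * x)) _ `[0%R, 1%R]
  setT (measurable_itv _) measurableT (continuous_integrable_unit (@continuous_sinM R b)) ih.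
have [-> ->] := @integral_unit_trig R (n - n').
rewrite mul0r subr_eq0 xpair_eqE.
have [<-|nn] := eqVneq n n'; last by rewrite andbF mul0r.
have [_ ->] := hermite_fun_orthonormal j k n.
by rewrite andbT mul1r; case: (j == k).
Qed.

(** * Completeness *)

(** The 1-periodic exponentials take the same values at x = 0 and x = 1; on the open strip they
separate points, and the two removed lines are negligible. *)
Definition open_strip : set plane := `]0%R, 1%R[ `*` setT.

Lemma measurable_open_strip : measurable open_strip.
Proof. exact: measurableX. Qed.

Lemma L2sq_strip (F : plane -> C) : cmeasurable_fun F ->
  L2sq leb2 (@strip R) F = L2sq leb2 open_strip F.
Proof.
move=> mF; pose N : set plane := ([set 0%R] `|` [set 1%R]) `*` setT.
have mN : measurable N by apply: measurableX => //; exact: measurableU.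
have ms : measurable (@strip R) by exact: measurableX.
rewrite /L2sq (@ge0_negligible_integral _ _ _ leb2 (@strip R) N)//.
- congr (integral _ _ _); apply/seteqP; split => -[x y] /=.
    move=> [[+ _] h]; rewrite /= !in_itv/= => /andP[x0 x1]; split => //.
    by rewrite /= in_itv/= !lt_neqAle x0 x1 !andbT; apply/andP; split;
      apply/eqP => xE; apply: h; rewrite /N /=; split => //=; [left|right].
  move=> [+ _]; rewrite /= !in_itv/= => /andP[x0 x1]; split.
    by split => //=; rewrite in_itv/= !ltW.
  by move=> [[|]/= xE _]; move: x0 x1; rewrite xE ltxx.
- by apply/measurable_EFinP; apply: measurable_funTS; exact: measurable_normsq.
- by move=> p _; rewrite lee_fin normsq_ge0.
- have mA : measurable ([set 0%R] `|` [set 1%R] : set R) by exact: measurableU.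
  transitivity (leb ([set 0%R] `|` [set 1%R]) * leb setT)%E.
    exact: (product_measure1E leb leb mA measurableT).
  suff -> : leb ([set 0%R] `|` [set 1%R]) = 0%E by rewrite mul0e.
  by apply: null_set_setU => //; exact: lebesgue_measure_set1.
Qed.

Definition psi_closure : set (plane -> C) := closed_span leb2 open_strip weighted_psi.

(** The functions of y that can be put in the closure with the frequency n in x. Each frequency
has its own shift, so each one is treated by a one-dimensional argument. *)
Definition fiber (n : int) : set (R -> R) :=
  [set g | psi_closure (fun p => cis (2 * pi * n%:~R * p.1) * (g p.2)%:C)].

Lemma psi_closureD (b : C) F G : psi_closure F -> psi_closure G ->
  psi_closure (fun p => b * F p + G p).
Proof.
apply: closed_spanD; [exact: measurable_open_strip|exact: cmeasurable_fun_weighted_psi].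
Qed.

Lemma fiber_linear n : linear_set (fiber n).
Proof.
move=> b f g Uf Ug; have := psi_closureD b%:C Uf Ug; congr (psi_closure _).
by apply/funext => p; rewrite rmorphD rmorphM /=; ring.
Qed.

Lemma cmeasurable_fun_fiber n (g : R -> R) : measurable_fun setT g ->
  cmeasurable_fun (fun p : plane => cis (2 * pi * n%:~R * p.1) * (g p.2)%:C).
Proof.
move=> mg; apply: cmeasurable_funM; first by apply: cmeasurable_fun_cis; exact: measurable_funM.
by apply: cmeasurable_fun_real; exact: (measurableT_comp mg measurable_snd).
Qed.

Lemma integrable_open_strip (h : R -> R) : leb.-integrable setT (EFin \o h) ->
  leb2.-integrable open_strip (fun p => (h p.2)%:E).
Proof.
move=> ih; have [ip _] := @integral_tensor _ _ _ _ _ leb leb (fun=> 1) h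
  `]0%R, 1%R[ setT (measurable_itv _) measurableT (integrable_one_unit_itv false true) ih.
by apply: eq_integrable ip => //; [exact: measurable_open_strip|move=> p _; rewrite mul1r].
Qed.

Lemma fiber_dominated n : dominated_closed leb setT (fun=> 1) (fiber n).
Proof.
move=> g_ g h Ug mg gc ih gh.
have nE m p : normsq (cis (2 * pi * n%:~R * p.1) * (g p.2)%:C -
    cis (2 * pi * n%:~R * p.1) * (g_ m p.2)%:C) = (g p.2 - g_ m p.2) ^+ 2 * 1.
  by rewrite mulr1 -mulrBr -rmorphB normsqM normsq_cis mul1r normsq_real.
apply: (closed_span_dominated measurable_open_strip cmeasurable_fun_weighted_psi
  (h := fun p => h p.2) Ug).
- exact: cmeasurable_fun_fiber.
- move=> p _; under eq_fun do rewrite nE.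
  by apply: cvg_sqr_dist; exact: gc.
- exact: integrable_open_strip.
- by move=> m p _; rewrite nE gh.
Qed.

Lemma fiber_hermite n m : fiber n (hermite_fun m n).
Proof.
exact: (closed_span_sub _ _ cmeasurable_fun_weighted_psi (lin_span_gen weighted_psi (m, n))).
Qed.

(** The Hermite polynomials in a y + c_n span the polynomials in a y + c_n, which are the
polynomials in y. *)
Lemma fiber_root_gauss n (p : {poly R}) : fiber n (fun y => p.[y] * root_gauss n y).
Proof.
have H q : fiber n (fun y => q.[a * y + c n] * root_gauss n y).
  elim/(@hermite_poly_ind R): q => [|k q r IHq IHr|m].
  - have := linear_set0 (@fiber_linear n) (fiber_hermite n 0); congr (fiber n _).
    by apply/funext => y; rewrite horner0 mul0r.
  - have := fiber_linear k IHq IHr; congr (fiber n _); apply/funext => y.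
    by rewrite hornerD hornerZ; ring.
  - have := linear_setZ (hermite_norm m)^-1 (@fiber_linear n) (fiber_hermite n m).
    congr (fiber n _); apply/funext => y; rewrite /hermite_fun.
    have m0 : hermite_norm m != 0.
      apply/eqP => m0; have := hermite_norm2 m; rewrite m0 expr0n !mul0r => /eqP.
      by rewrite eq_sym oner_eq0.
    by move: (hermite_norm m) m0 => N N0; field.
have := H (p \Po (a^-1 *: ('X - (c n)%:P))); congr (fiber n _); apply/funext => y.
rewrite horner_comp !hornerE addrK mulKf// gt_eqF//.
exact: hermite_scale_gt0.
Qed.

Lemma gauss_decay_root n : gauss_decay (root_gauss n).
Proof.
split; first exact: measurable_root_gauss.
exists a, (c n), 1, 0; split; first exact: hermite_scale_gt0.
by move=> y; rewrite expr2 root_gauss_sqr mul0r expR0 !mul1r.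
Qed.

Definition common_gauss (y : R) : R := expR (- nu * y ^+ 2).

(** Completing the square shows that a factor exp (a c_n y) centres the Gaussian attached to the
frequency n, up to a constant. *)
Lemma common_gaussE n y :
  common_gauss y = expR (c n ^+ 2 / 2) * (expR (a * c n * y) * root_gauss n y).
Proof.
rewrite /common_gauss /root_gauss -!expRD; congr expR.
rewrite (_ : nu = a ^+ 2 / 2); last by rewrite hermite_scale2; field.
by field.
Qed.

Lemma fiber_common_gauss n (p : {poly R}) : fiber n (fun y => p.[y] * common_gauss y).
Proof.
have := expR_mul (a * c n) (@fiber_linear n) (@fiber_dominated n)
  (gauss_decay_root n) (fiber_root_gauss n) p.
move=> /(linear_setZ (expR (c n ^+ 2 / 2)) (@fiber_linear n)); congr (fiber n _).
by apply/funext => y; rewrite (common_gaussE n); ring.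
Qed.

Lemma gauss_decay_common : gauss_decay common_gauss.
Proof.
have h : gauss_decay (fun y => (expR (c 0 ^+ 2 / 2) * expR (a * c 0 * y)) * root_gauss 0 y).
  apply: gauss_decayM; last exact: gauss_decay_root.
    by apply: measurable_funM => //; exact: measurable_expR_linear.
  by apply: exp_growthM; [exact: exp_growth_cst|exact: exp_growth_expR].
move: h; congr gauss_decay; apply/funext => y; rewrite (common_gaussE 0) mulrA//.
Qed.

Lemma fiber_trig n (t s : R) :
  fiber n (fun y => cos (t * y + s) * common_gauss y) /\ fiber n (fun y =>
    sin (t * y + s) * common_gauss y).
Proof.
have Uc := cos_mul t (@fiber_linear n) (@fiber_dominated n) gauss_decay_common (fiber_common_gauss n) 1.
have Us := sin_mul t (@fiber_linear n) (@fiber_dominated n) gauss_decay_common (fiber_common_gauss n) 1.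
have Z b f : fiber n f -> fiber n (fun y => b * f y) by apply: linear_setZ; exact: fiber_linear.
split.
  have := linear_setB (@fiber_linear n) (Z (cos s) _ Uc) (Z (sin s) _ Us); congr (fiber n _).
  by apply/funext => y; rewrite cosD -polyC1 !hornerC; ring.
have := linear_setD (@fiber_linear n) (Z (cos s) _ Us) (Z (sin s) _ Uc); congr (fiber n _).
by apply/funext => y; rewrite sinD -polyC1 !hornerC; ring.
Qed.

Lemma psi_closureZ (b : C) F : psi_closure F -> psi_closure (fun p => b * F p).
Proof.
move=> cF; have c0 : psi_closure (fun=> 0).
  by have := psi_closureD (-1) cF cF; congr (psi_closure _); apply/funext => p; ring.
by have := psi_closureD b cF c0; congr (psi_closure _); apply/funext => p; rewrite addr0.
Qed.

Definition real_closure : set (plane -> R) :=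
  [set g | psi_closure (fun p => (g p * common_gauss p.2)%:C)].

Lemma real_closure_linear : linear_set real_closure.
Proof.
move=> b f g Vf Vg; have := psi_closureD b%:C Vf Vg; congr (psi_closure _).
by apply/funext => p; rewrite -rmorphM -rmorphD; congr (_%:C); ring.
Qed.

Lemma measurable_common_gauss : measurable_fun setT common_gauss.
Proof. by case: gauss_decay_common. Qed.

Lemma measurable_common_gauss_snd : measurable_fun setT (fun p : plane => common_gauss p.2).
Proof. exact: (measurableT_comp measurable_common_gauss measurable_snd). Qed.

Lemma real_closure_dominated :
  dominated_closed leb2 open_strip (fun p => common_gauss p.2 ^+ 2) real_closure.
Proof.
move=> g_ g h Vg mg gc ih gh.
have nE m p : normsq ((g p * common_gauss p.2)%:C - (g_ m p * common_gauss p.2)%:C) =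
    (g p - g_ m p) ^+ 2 * common_gauss p.2 ^+ 2.
  by rewrite -rmorphB normsq_real -mulrBl exprMn.
apply: (closed_span_dominated measurable_open_strip cmeasurable_fun_weighted_psi (h := h) Vg) =>
  //.
- by apply: cmeasurable_fun_real; apply: measurable_funM => //;
    exact: measurable_common_gauss_snd.
- move=> p Dp; under eq_fun do rewrite nE.
  by apply: cvg_sqr_dist; exact: gc.
- by move=> m p Dp; rewrite nE gh.
Qed.

(** Generating by cosines with an arbitrary phase makes the span stable under products: the
product of two cosines is half the sum of the cosines of the sum and of the difference. *)
Inductive trigpoly : (plane -> R) -> Prop :=
| trigpoly_cos (n : int) (t s : R) :
    trigpoly (fun p => cos (2 * pi * n%:~R * p.1 + t * p.2 + s))
| trigpoly_lin (b : R) f g :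
    trigpoly f -> trigpoly g -> trigpoly (fun p => b * f p + g p).

Lemma trigpoly_linear : linear_set trigpoly.
Proof. by move=> b f g; exact: trigpoly_lin. Qed.

Lemma trigpoly_cst (b : R) : trigpoly (fun=> b).
Proof.
have := linear_setZ b trigpoly_linear (trigpoly_cos 0 0 0); congr trigpoly.
by apply/funext => p; rewrite mulr0 !mul0r !addr0 cos0 mulr1.
Qed.

Lemma trigpoly_measurable f : trigpoly f -> measurable_fun setT f.
Proof.
elim=> [n t s|b {}f g _ mf _ mg]; last by apply: measurable_funD => //; exact: measurable_funM.
apply: measurableT_comp; first by apply: continuous_measurable_fun; exact: continuous_cos.
by apply: measurable_funD => //; apply: measurable_funD; exact: measurable_funM.
Qed.

Lemma trigpoly_algebra : bounded_algebra trigpoly.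
Proof.
split.
- exact: trigpoly_cst.
- exact: trigpoly_linear.
- move=> f g tf tg; elim: tf => {f} [n t s|b f1 f2 _ tf1 _ tf2]; last first.
    have := trigpoly_linear b tf1 tf2; congr trigpoly; apply/funext => p; ring.
  elim: tg => {g} [m u v|b g1 g2 _ tg1 _ tg2]; last first.
    have := trigpoly_linear b tg1 tg2; congr trigpoly; apply/funext => p; ring.
  have := linear_setZ 2^-1 trigpoly_linear (linear_setD trigpoly_linear
    (trigpoly_cos (n + m) (t + u) (s + v)) (trigpoly_cos (n - m) (t - u) (s - v))).
  congr trigpoly; apply/funext => p.
  set A := 2 * pi * n%:~R * p.1 + t * p.2 + s; set B := 2 * pi * m%:~R * p.1 + u * p.2 + v.
  rewrite (_ : 2 * pi * (n + m)%:~R * p.1 + _ + _ = A + B); last by rewrite intrD /A /B; ring.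
  rewrite (_ : 2 * pi * (n - m)%:~R * p.1 + _ + _ = A - B); last by rewrite intrB /A /B; ring.
  by rewrite cosD cosB; field.
- move=> f; elim=> {f} [n t s|b f g _ [K fK] _ [L gL]].
    by exists 1 => p; rewrite ler_norml cos_geN1 cos_le1.
  exists (`|b| * K + L) => p; rewrite (le_trans (ler_normD _ _))// lerD// normrM.
  exact: ler_wpM2l.
Qed.

(** The addition formula separates x from y, and cos and sin of 2 pi n x are combinations of the
exponentials of frequencies n and - n. *)
Lemma trigpoly_real_closure : trigpoly `<=` real_closure.
Proof.
move=> f; elim=> {f} [n t s|b f g _ Vf _ Vg]; last exact: real_closure_linear.
have [c1 s1] := fiber_trig n t s; have [c2 s2] := fiber_trig (- n) t s.
(* cos = (e + conj e) / 2 and - sin = (i / 2) (e - conj e) *)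
pose h : C := 2^-1%:C; pose k : C := 0 +i* 2^-1.
have := psi_closureD h c1 (psi_closureD h c2 (psi_closureD k s1 (psi_closureZ (- k) s2))).
congr (psi_closure _); apply/funext => p.
set th := 2 * pi * n%:~R * p.1.
have -> : 2 * pi * (- n)%:~R * p.1 = - th by rewrite /th mulrNz; ring.
rewrite -(addrA th); cbv beta; set q := t * p.2 + s.
rewrite (cosD th) cisN /cis /h /k.
by apply/eqP; rewrite eq_complex /=; apply/andP; split; apply/eqP; field.
Qed.

(** The difference of cosines is 2 sin (pi x) sin (pi (b - x)), whose first factor is positive
for 0 < x < 1 and whose second factor has the sign of b - x. *)
Lemma lt_abscissa_cos (b : R) (p : plane) : 0 < b < 1 -> open_strip p ->
  p.1 < b <-> 0 < cos (2 * pi * p.1 - pi * b) - cos (pi * b).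
Proof.
move=> /andP[b0 b1] [/= + _]; rewrite in_itv/= => /andP[x0 x1]; set x := p.1 in x0 x1 *.
have pi0 := pi_gt0 R.
have -> : cos (2 * pi * x - pi * b) - cos (pi * b) = 2 * (sin (pi * x) * sin (pi * (b - x))).
  rewrite (_ : 2 * pi * x - pi * b = pi * x - pi * (b - x)); last by ring.
  rewrite [in X in _ - X](_ : pi * b = pi * x + pi * (b - x)); last by ring.
  by rewrite cosB cosD; ring.
have sx : 0 < sin (pi * x) by apply: sin_gt0_pi; rewrite mulr_gt0//= gtr_pMr.
rewrite pmulr_rgt0// pmulr_rgt0//; split => [xb|].
  apply: sin_gt0_pi; rewrite mulr_gt0 ?subr_gt0//= gtr_pMr//; lra.
move=> sb; rewrite ltNge; apply/negP => bx; move: sb.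
rewrite (_ : pi * (b - x) = - (pi * (x - b))); last by ring.
rewrite sinN oppr_gt0; apply/negP; rewrite -leNgt; apply: sin_ge0_pi.
have xb0 : 0 <= x - b by lra.
have xb1 : x - b <= 1 by lra.
by apply/andP; split; [apply: mulr_ge0 => //|apply: ler_piMr => //]; exact: ltW.
Qed.

(** It suffices that both coordinates be measurable for the generated sigma-algebra, and the
second one is a pointwise limit of functions that are. *)
Lemma trigpoly_generates : @measurable _ plane `<=` <<s bounded_limit open_strip trigpoly >>.
Proof.
set G := bounded_limit open_strip trigpoly.
have ltG (f : plane -> R) (b : R) : measurable_fun setT f ->
    (exists2 g, trigpoly g & forall p, open_strip p -> f p < b <-> 0 < g p) ->
    <<s G >> [set p | f p < b].
  move=> mf [g tg fg]; apply: sub_sigma_algebra.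
  apply: (bounded_limit_pos trigpoly_algebra tg) => //.
  rewrite (_ : [set p | _] = setT `&` f @^-1` `]-oo, b[%classic).
    by apply: mf => //; exact: measurable_itv.
  by rewrite setTI; apply/seteqP; split => p /=; rewrite in_itv.
have m1 : measurable_fun setT (fun p : g_sigma_algebraType G => p.1 : R).
  apply: (measurability _ (RGenInftyO.measurableE R)) => _ [_ [b ->] <-].
  rewrite setTI (_ : _ @^-1` _ = [set p | p.1 < b]); last first.
    by apply/seteqP; split => p /=; rewrite in_itv.
  apply: ltG => //; have [b0|b0] := leP b 0.
    exists (fun=> 0); first exact: trigpoly_cst.
    move=> p [/= + _]; rewrite in_itv/= ltxx => /andP[x0 _]; split => // xb.
    by have := lt_trans x0 (lt_le_trans xb b0); rewrite ltxx.
  have [b1|b1] := leP 1 b.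
    exists (fun=> 1); first exact: trigpoly_cst.
    move=> p [/= + _]; rewrite in_itv/= => /andP[_ x1]; split => // _.
    exact: lt_le_trans b1.
  exists (fun p => cos (2 * pi * p.1 - pi * b) - cos (pi * b)).
    have := linear_setB trigpoly_linear (trigpoly_cos 1 0 (- (pi * b))) (trigpoly_cst (cos (pi * b))).
    by congr trigpoly; apply/funext => p; rewrite mulr1 mul0r addr0.
  by move=> p; apply: lt_abscissa_cos; rewrite b0.
have m2 : measurable_fun setT (fun p : g_sigma_algebraType G => p.2 : R).
  apply: (@measurable_fun_cvg _ (g_sigma_algebraType G) R setT
    (fun n p => n.+1%:R * sin (n.+1%:R^-1 * p.2))); last first.
    by move=> p _; exact: cvg_scaled_sin.
  move=> n; apply: (measurability _ (RGenInftyO.measurableE R)) => _ [_ [b ->] <-].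
  rewrite setTI (_ : _ @^-1` _ = [set p | n.+1%:R * sin (n.+1%:R^-1 * p.2) < b]); last first.
    by apply/seteqP; split => p /=; rewrite in_itv.
  have tg : trigpoly (fun p => b - n.+1%:R * sin (n.+1%:R^-1 * p.2)).
    have := linear_setB trigpoly_linear (trigpoly_cst b)
      (linear_setZ n.+1%:R trigpoly_linear (trigpoly_cos 0 n.+1%:R^-1 (- (pi / 2)))).
    congr trigpoly; apply/funext => p.
    by rewrite mulr0 mul0r add0r cosB cos_pihalf sin_pihalf mulr0 mulr1 add0r.
  apply: ltG.
    have := trigpoly_measurable (linear_setB trigpoly_linear (trigpoly_cst b) tg).
    by congr measurable_fun; apply/funext => p; ring.
  by exists (fun p => b - n.+1%:R * sin (n.+1%:R^-1 * p.2)) => // p _; rewrite subr_gt0.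
have mid : measurable_fun setT (fun p : g_sigma_algebraType G => (p.1, p.2) : plane).
  exact: measurable_fun_pair.
move=> B mB; have := mid measurableT B mB; rewrite setTI.
by rewrite (_ : _ @^-1` B = B)//; apply/seteqP; split => -[].
Qed.

(** Here the Stone-Weierstrass theorem is applied, to the finite measure with density
e^(-2 nu y^2) on the open strip. *)
Lemma real_closure_all (g : plane -> R) : measurable_fun setT g ->
  leb2.-integrable open_strip (fun p => (g p ^+ 2 * common_gauss p.2 ^+ 2)%:E) -> real_closure g.
Proof.
apply: (dense_of_generating_algebra measurable_open_strip _ _ trigpoly_algebra
  trigpoly_real_closure real_closure_linear real_closure_dominated trigpoly_generates).
- by move=> p; exact: sqr_ge0.
- exact: (integrable_open_strip (gauss_decay_integrable gauss_decay_common)).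
Qed.

(** Real and imaginary parts are treated separately, after division by the common Gaussian. *)
Lemma finite_L2sq_closure (F : plane -> C) : cmeasurable_fun F ->
  (L2sq leb2 open_strip F < +oo)%E -> psi_closure F.
Proof.
move=> mF Ffin; have [mR mI] := mF.
have part (u : plane -> R) : measurable_fun setT u -> (forall p, u p ^+ 2 <= normsq (F p)) ->
    psi_closure (fun p => (u p)%:C).
  move=> mu uF.
  have muw : measurable_fun setT (fun p => u p * expR (nu * p.2 ^+ 2)).
    apply: measurable_funM => //; apply: measurableT_comp => //.
    by apply: measurable_funM => //; exact: measurable_funX.
  have uwE p : u p * expR (nu * p.2 ^+ 2) * common_gauss p.2 = u p.
    by rewrite /common_gauss -mulrA -expRD mulNr subrr expR0 mulr1.
  have : real_closure (fun p => u p * expR (nu * p.2 ^+ 2)).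
    apply: real_closure_all => //.
    under eq_fun do rewrite -exprMn uwE.
    have mu2 : measurable_fun open_strip (EFin \o (fun p => u p ^+ 2)).
      by apply/measurable_EFinP; apply: measurable_funTS; exact: measurable_funX.
    apply/integrableP; split => //; apply: le_lt_trans Ffin.
    apply: ge0_le_integral => //.
    - exact: measurable_open_strip.
    - exact: measurableT_comp.
    - by apply/measurable_EFinP; apply: measurable_funTS; exact: measurable_normsq.
    - by move=> p _; rewrite /= ger0_norm ?sqr_ge0// lee_fin uF.
  by congr (psi_closure _); apply/funext => p; rewrite uwE.
have cR : psi_closure (fun p => (complex.Re (F p))%:C).
  by apply: part => // p; rewrite lerDl sqr_ge0.
have cI : psi_closure (fun p => (complex.Im (F p))%:C).
  by apply: part => // p; rewrite lerDr sqr_ge0.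
have := psi_closureD 'i%C cI cR; congr (psi_closure _); apply/funext => p.
by rewrite [RHS]complexE addrC.
Qed.

(** [weighted] is linear and isometric, so an approximation of [weighted f] by the weighted
family is an approximation of f by the psi with the same coefficients. *)
Theorem psi_complete : complete_system alpha nu (psi alpha nu).
Proof.
move=> f [mf _ ffin] eps eps0.
have mwf := cmeasurable_fun_weighted mf.
have [_ dense] : psi_closure (weighted f).
  by apply: finite_L2sq_closure => //; rewrite -L2sq_strip// -sqnorm_weighted.
have e20 : 0 < eps ^+ 2 by rewrite exprn_gt0.
have [G [s [c GE]] hG] := dense _ e20.
exists s, c; rewrite sqnorm_weighted.
have -> : weighted (fun z => f z - \sum_(k <- s) c k * psi alpha nu k z) =
    (fun p => weighted f p - G p).
  apply/funext => p; rewrite GE -[in RHS](eq_bigr _ (fun k _ => congr1 (fun h =>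
    c k * h p) (weighted_psiE k))).
  rewrite /weighted mulrBl mulrBr; congr (_ - _).
  rewrite mulr_suml mulr_sumr; apply: eq_bigr => k _; ring.
rewrite L2sq_strip//.
apply: cmeasurable_funB => //; apply: (cmeasurable_fun_span cmeasurable_fun_weighted_psi);
  by exists s, c.
Qed.

End WeightedFamily.

Theorem theorem4p1 (R : realType) (nu alpha : R) (hnu : 0 < nu) :
  complete_orthonormal_system alpha nu (psi alpha nu).
Proof.
split; last exact: psi_complete.
split; first exact: psi_L2_auto.
exact: psi_orthonormal.
Qed.
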